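(* The spindle transform $\mathcal{S}$ is equivalent to the weighted cylinder transform $\mathcal{C}$ via the diffeomorphism $v:B^3_{\alpha_1,\alpha_2}\to B^3_{\epsilon_1,\epsilon_2}$, $v(x)=\left(\sqrt{1+\frac{1}{|x|^2}}-\frac{1}{|x|}\right)\frac{x}{|x|}$: for every $f\in C_0^\infty(B^3_{\epsilon_1,\epsilon_2})$ and all $(s,\theta)\in(0,1)\times S^2$, $$\mathcal{S}f(s,\theta)=\mathcal{C}\tilde f(s,\theta),\qquad \tilde f(x)=|\det J_v(x)|\,f(v(x)),$$ where $J_v$ is the Jacobian matrix of $v$.
   Context: Fix $0<\epsilon_1<\epsilon_2<1$ and put $\alpha_i=2\epsilon_i/(1-\epsilon_i^2)$, $i=1,2$. Let $B^3_{a,b}=\{x\in\mathbb{R}^3: a<|x|<b\}$. For $y\in B^3_{\epsilon_1,\epsilon_2}$, $\theta\in S^2$, $s\in(0,1)$ let $h(s,y,\theta)=\frac{4|y\times\theta|^2}{(1-|y|^2)^2}-s$, with gradient in $y$ given by $\nabla_y h(s,y,\theta)=8\frac{y-(y\cdot\theta)\theta}{(1-|y|^2)^2}+16\frac{|y\times\theta|^2y}{(1-|y|^2)^3}$. The spindle transform of $f\in C_0^\infty(B^3_{\epsilon_1,\epsilon_2})$ is $$\mathcal{S}f(s,\theta)=\int_{B^3_{\epsilon_1,\epsilon_2}}\frac{\delta\left(\frac{4|y\times\theta|^2}{(1-|y|^2)^2}-s\right)}{|\nabla_y h(s,y,\theta)|}f(y)\,dy,$$ and the weighted cylinder transform of $f\in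 C_0^\infty(B^3_{\alpha_1,\alpha_2})$ is $$\mathcal{C}f(s,\theta)=\int_{B^3_{\alpha_1,\alpha_2}}\frac{\delta\left(|x|^2-(x\cdot\theta)^2-s\right)}{|(\nabla_y h)(s,v(x),\theta)|}f(x)\,dx.$$ Here $\delta(G)$ is the pullback of the Dirac delta by $G$ (surface measure on $\{G=0\}$ divided by the norm of the gradient of $G$). *)

(* Defs.v *)
From HB Require Import structures.
From mathcomp Require Import all_boot all_order all_algebra.
From mathcomp Require Import all_classical all_reals all_analysis.

Set Implicit Arguments.
Unset Strict Implicit.
Unset Printing Implicit Defensive.

Import Order.TTheory GRing.Theory Num.Theory.
Import numFieldNormedType.Exports.

Local Open Scope classical_set_scope.
Local Open Scope ring_scope.

(* The library norm `|x| on 'rV[R]_3 is the sup norm; the Euclidean one is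
   enorm. The two induce the same topology and the same notions of
   differentiability. *)
Definition dotp (R : realType) (x y : 'rV[R]_3) : R :=
  \sum_(i < 3) x 0 i * y 0 i.

Definition enorm (R : realType) (x : 'rV[R]_3) : R := Num.sqrt (dotp x x).

Definition crossp (R : realType) (x y : 'rV[R]_3) : 'rV[R]_3 :=
  \row_(i < 3) (x 0 (i + 1) * y 0 (i + 2%:R) - x 0 (i + 2%:R) * y 0 (i + 1)).

Definition gradient (R : realType) (G : 'rV[R]_3 -> R) (x : 'rV[R]_3)
    : 'rV[R]_3 :=
  \row_(i < 3) 'D_('e_i) G x.

Definition annulus (R : realType) (a b : R) : set 'rV[R]_3 :=
  [set x | a < enorm x < b].

Definition iter_partial (R : realType) (W : normedModType R) (l : seq 'I_3)
    (f : 'rV[R]_3 -> W) : 'rV[R]_3 -> W :=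
  foldr (fun (i : 'I_3) (g : 'rV[R]_3 -> W) => 'D_('e_i) g) f l.

(* C^oo on the open set A: every iterated partial derivative exists and is
   differentiable at every point of A. *)
Definition smooth_on (R : realType) (W : normedModType R) (A : set 'rV[R]_3)
    (f : 'rV[R]_3 -> W) : Prop :=
  forall (l : seq 'I_3) (x : 'rV[R]_3),
    A x -> differentiable (iter_partial l f) x.

(* C_0^oo(B), each function being extended by zero to the whole space. *)
Definition test_function (R : realType) (B : set 'rV[R]_3)
    (f : 'rV[R]_3 -> R) : Prop :=
  [/\ smooth_on setT f,
      compact (closure [set x | f x != 0]) &
      closure [set x | f x != 0] `<=` B].

Definition diffeomorphism (R : realType) (A B : set 'rV[R]_3)
    (g : 'rV[R]_3 -> 'rV[R]_3) : Prop :=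
  [/\ set_bij A B g, smooth_on A g &
      exists2 k : 'rV[R]_3 -> 'rV[R]_3,
        smooth_on B k & forall x, A x -> k (g x) = x].

Section surface_measure.
Variable R : realType.
Implicit Types (M : set 'rV[R]_3) (U K : set (R * R))
  (psi : R * R -> 'rV[R]_3).

Definition normal psi (u : R * R) : 'rV[R]_3 :=
  crossp ('D_((1, 0) : R * R) psi u) ('D_((0, 1) : R * R) psi u).

(* psi is a regular C^1 parametrization, with domain U, of a part of M. *)
Definition regular_patch M U psi : Prop :=
  [/\ open U, set_fun U M psi, set_inj U psi &
      forall u, U u ->
        [/\ differentiable psi u,
            {for u, continuous ('D_((1, 0) : R * R) psi)},
            {for u, continuous ('D_((0, 1) : R * R) psi)} &
            normal psi u != 0]].

Definition patch_area psi K : \bar R :=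
  (\int[(@lebesgue_measure R \x @lebesgue_measure R)%E]_(u in K)
     (enorm (normal psi u))%:E)%E.

(* Surface measure of the surface M in R^3, as the outer measure generated by
   the areas of the measurable pieces of regular patches of M. Since area does
   not depend on the parametrization, it agrees with the usual area
   |psi_u x psi_v| du dv on the Borel subsets of a patch. Borel sets are
   Caratheodory-measurable: a piece K of a patch psi is cut by a Borel set B
   into the pieces K `&` psi @^-1` B and K `\` psi @^-1` B. *)
Definition surface_measure M (A : set 'rV[R]_3) : \bar R :=
  ereal_inf [set e : \bar R |
    exists (psi : nat -> R * R -> 'rV[R]_3) (U K : nat -> set (R * R)),
      [/\ forall k, regular_patch M (U k) (psi k),
          forall k, measurable (K k) /\ K k `<=` U k,
          A `&` M `<=` \bigcup_k (psi k @` K k) &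
          e = (\sum_(0 <= k <oo) patch_area (psi k) (K k))%E]].

(* R^3 with its Borel sigma-algebra. *)
Definition borel3 := g_sigma_algebraType (@open 'rV[R]_3).

Definition surface_integral M (g : 'rV[R]_3 -> R) : R :=
  fine (\int[surface_measure M : set borel3 -> \bar R]_(x in (M : set borel3))
          (g x)%:E)%E.

(* The integral of delta(G) g over D. *)
Definition delta_integral (D : set 'rV[R]_3) (G g : 'rV[R]_3 -> R) : R :=
  surface_integral [set x | D x /\ G x = 0]
    (fun x => g x / enorm (gradient G x)).

End surface_measure.

Section transforms.
Variable R : realType.
Implicit Types (f : 'rV[R]_3 -> R) (x y theta : 'rV[R]_3) (s eps : R).

Definition spindle_h s y theta : R :=
  4%:R * enorm (crossp y theta) ^+ 2 / (1 - enorm y ^+ 2) ^+ 2 - s.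

Definition grad_h s y theta : 'rV[R]_3 :=
  gradient (fun z => spindle_h s z theta) y.

Definition spindle_transform eps1 eps2 f s theta : R :=
  delta_integral (annulus eps1 eps2) (fun y => spindle_h s y theta)
    (fun y => f y / enorm (grad_h s y theta)).

Definition vmap x : 'rV[R]_3 :=
  (Num.sqrt (1 + (enorm x ^+ 2)^-1) - (enorm x)^-1) *: ((enorm x)^-1 *: x).

Definition alpha eps : R := 2%:R * eps / (1 - eps ^+ 2).

Definition cylinder_transform alpha1 alpha2 f s theta : R :=
  delta_integral (annulus alpha1 alpha2)
    (fun x => enorm x ^+ 2 - dotp x theta ^+ 2 - s)
    (fun x => f x / enorm (grad_h s (vmap x) theta)).

Definition weighted_pullback f x : R := `|\det ('J vmap x)| * f (vmap x).

End transforms.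

(* Main.v *)
Require Import Defs.
From HB Require Import structures.
From mathcomp Require Import all_boot all_order all_algebra.
From mathcomp Require Import all_classical all_reals all_analysis.
From mathcomp Require Import measurable_realfun.
From mathcomp Require Import ring lra.

(* The map v(x) = x / (1 + sqrt(1 + |x|^2)) is smooth on the whole space, is
   inverted on the unit ball by k(y) = 2 y / (1 - |y|^2), and turns the defining
   function h of the spindle into G(x) = |x|^2 - (x . theta)^2 - s, so it maps
   the cylinder {G = 0} onto the spindle {h = 0}.
   If n is normal to {G = 0} at x then n is parallel to grad G(x), which is the
   transpose of Dv(x) applied to grad h(v(x)); since the cofactor matrix of Dv
   transports normals, v scales area by
     J(x) = |det Dv(x)| |grad h(v(x))| / |grad G(x)|,
   exactly the ratio of the two integrands.
   Surface measure is an infimum over coverings by patches. Cutting the pieces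
   of a covering by Borel sets shows that it is sigma-additive on them, and
   composing the patches with v or k shows that S(v(A)) lies between inf_A J and
   sup_A J times S(A). Cutting {J > 0} into the sets where J is within a factor
   r < 1 of a constant, and letting r tend to 1, gives the equality of the
   integrals, with no finiteness assumption on the measures. *)

Set Implicit Arguments.
Unset Strict Implicit.
Unset Printing Implicit Defensive.

Import Order.TTheory GRing.Theory Num.Theory.
Import numFieldNormedType.Exports.

Local Open Scope classical_set_scope.
Local Open Scope ring_scope.

(** * Smooth functions *)

Section differentiability.
Variable R : realType.

(** The zero map serves as differential, because the remainder is exactly zero near [x]. *)
Lemma near0_differentiable (V W : normedModType R) (r : V -> W) (x : V) :
  (\near x, r x = 0) -> differentiable r x.
Proof.
move=> r0; have rx0 : r x = 0 by exact: (nbhs_singleton r0).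
have c0 : continuous (\0 : V -> W) by move=> z; exact: cvg_cst.
have E : r \o shift x = cst (r x) + (\0 : {linear V -> W}) +o_ (0 : V) id.
  apply/eqaddoP => e e0.
  have r0' : \forall h \near (0 : V), r (h + x) = 0.
    by move: r0; rewrite (near_shift 0) /=; apply: filterS => h; rewrite subr0.
  apply: filterS r0' => h rh.
  suff -> : (r \o shift x - (cst (r x) + (\0 : {linear V -> W}))) h = 0.
    by rewrite normr0 mulr_ge0 // ltW.
  by rewrite /= -[LHS]/(r (h + x) - (r x + 0)) rx0 addr0 subr0.
have D := diff_unique c0 E.
by apply/diff_locallyP; rewrite D; split.
Qed.

(** [g] is [f] plus a function vanishing near [x]. Formulas that agree only locally can thus be
    exchanged under differentiation. *)
Lemma near_eq_differentiable (V W : normedModType R) (f g : V -> W) (x : V) :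
  (\near x, f x = g x) -> differentiable f x -> differentiable g x.
Proof.
move=> fg df; have -> : g = f + (g - f) by rewrite addrC subrK.
apply: differentiableD => //; apply: near0_differentiable.
by apply: filterS fg => z fgz; rewrite -[LHS]/(g z - f z) fgz subrr.
Qed.

Lemma derive_coord (V : normedModType R) m n (F : V -> 'M[R]_(m, n)) (x v : V)
    i j : derivable F x v ->
  'D_v (fun z => F z i j) x = ('D_v F x) i j.
Proof. by move=> dF; rewrite derive_mx // mxE. Qed.

Lemma differentiable_mx_coord (V : normedModType R) m n
    (F : V -> 'M[R]_(m, n)) (x : V) i j :
  differentiable F x -> differentiable (fun z => F z i j) x.
Proof.
move=> dF; apply: (@differentiable_comp _ _ _ _ F (fun N => N i j)) => //.
exact: differentiable_coord.
Qed.

End differentiability.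

Section smoothness.
Variable R : realType.
Local Notation V := 'rV[R]_3.

(* Cn peels off the innermost derivative of iter_partial, the one closest to f,
   so that closure properties follow by induction on n. *)
Fixpoint Cn (W : normedModType R) (n : nat) (A : set V) (f : V -> W) : Prop :=
  match n with
  | 0%N => forall x, A x -> differentiable f x
  | n'.+1 => (forall x, A x -> differentiable f x) /\
             forall i : 'I_3, Cn n' A ('D_('e_i) f)
  end.

Lemma Cn_differentiable (W : normedModType R) n A (f : V -> W) x :
  Cn n A f -> A x -> differentiable f x.
Proof. by case: n => [|n] /=; [apply|case=> + _; apply]. Qed.

Lemma Cn_continuous (W : normedModType R) n A (f : V -> W) x :
  Cn n A f -> A x -> {for x, continuous f}.
Proof. by move=> fA Ax; exact/differentiable_continuous/(Cn_differentiable fA). Qed.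

Lemma CnW (W : normedModType R) n A (f : V -> W) : Cn n.+1 A f -> Cn n A f.
Proof.
elim: n f => [|n IHn] f; first by case.
by case=> df Hf; split => // i; apply: IHn.
Qed.

Lemma sub_Cn (W : normedModType R) n (A B : set V) (f : V -> W) :
  A `<=` B -> Cn n B f -> Cn n A f.
Proof.
move=> AB; elim: n f => [|n IHn] f /=; first by move=> df x /AB; exact: df.
by case=> df Hf; split => [x /AB|i]; [exact: df|exact: IHn].
Qed.

(** [foldr] applies the last index of the list first, so the innermost derivative is split off with
    [rcons]. *)
Lemma smooth_onP (W : normedModType R) A (f : V -> W) :
  smooth_on A f <-> forall n, Cn n A f.
Proof.
split=> [fA n|fA l].
  elim: n f fA => [|n IHn] f fA; first exact: (fA [::]).
  split=> [|i]; first exact: (fA [::]).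
  apply: IHn => l x Ax; have := fA (rcons l i) x Ax.
  by rewrite /iter_partial foldr_rcons.
suff: forall x, A x -> differentiable (iter_partial l f) x by [].
elim/last_ind: l f fA => [|l i IHl] f fA; first exact: (fA 0%N).
rewrite /iter_partial foldr_rcons; apply: (IHl ('D_('e_i) f)) => n.
by have [_ ] := fA n.+1; apply.
Qed.

(** Openness of [A] turns equality on [A] into equality near each of its points, which passes to
    derivatives. The closure lemmas below use it to replace a derivative by its explicit formula,
    known on [A] only. *)
Lemma Cn_ext (W : normedModType R) n (A : set V) (f g : V -> W) : open A ->
  (forall x, A x -> f x = g x) -> Cn n A f -> Cn n A g.
Proof.
move=> oA; elim: n f g => [|n IHn] f g fg.
  move=> df x Ax; apply: near_eq_differentiable (df _ Ax).
  by apply: filterS (open_nbhs_nbhs (conj oA Ax)).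
have fg_near x : A x -> \near x, f x = g x.
  by move=> Ax; apply: filterS (open_nbhs_nbhs (conj oA Ax)).
case=> df Hf; split=> [x Ax|i].
  exact: near_eq_differentiable (fg_near _ Ax) (df _ Ax).
apply: IHn (Hf i) => x Ax; exact/near_eq_derive/fg_near.
Qed.

Lemma Cn_cst (W : normedModType R) n (A : set V) (w : W) : Cn n A (fun=> w).
Proof.
elim: n w => [|n IHn] w /=; first by move=> x _; exact: differentiable_cst.
split=> [x _|i]; first exact: differentiable_cst.
suff -> : 'D_('e_i) (fun=> w) = (fun=> 0) :> (V -> W) by [].
by apply/funext => x; exact: derive_cst.
Qed.

Section closure.
Variable A : set V.
Hypothesis oA : open A.

Lemma CnD (W : normedModType R) n (f g : V -> W) :
  Cn n A f -> Cn n A g -> Cn n A (fun x => f x + g x).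
Proof.
elim: n f g => [|n IHn] f g /=.
  by move=> df dg x Ax; apply: differentiableD; [exact: df|exact: dg].
move=> [df Hf] [dg Hg]; split=> [x Ax|i].
  by apply: differentiableD; [exact: df|exact: dg].
apply: Cn_ext (IHn _ _ (Hf i) (Hg i)) => // x Ax.
by rewrite -deriveD //; apply: diff_derivable; [exact: df|exact: dg].
Qed.

Lemma CnZl (W : normedModType R) n (f : V -> R) (w : W) :
  Cn n A f -> Cn n A (fun x => f x *: w).
Proof.
elim: n f => [|n IHn] f /=.
  by move=> df x Ax; apply: differentiableZl; exact: df.
move=> [df Hf]; split=> [x Ax|i]; first by apply: differentiableZl; exact: df.
apply: Cn_ext (IHn _ (Hf i)) => // x Ax.
have dx := df _ Ax; rewrite (deriveE _ dx) deriveE ?diffZl //.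
exact: differentiableZl.
Qed.

(** By the Leibniz rule the derivative is a sum of products of one undifferentiated factor, lowered
    to order [n] by [CnW], and one derivative of order [n]. *)
Lemma CnM n (f g : V -> R) :
  Cn n A f -> Cn n A g -> Cn n A (fun x => f x * g x).
Proof.
elim: n f g => [|n IHn] f g.
  by move=> df dg x Ax; apply: differentiableM; [exact: df|exact: dg].
move=> Cf Cg; split=> [x Ax|i].
  apply: differentiableM; [exact: Cn_differentiable Cf Ax|].
  exact: Cn_differentiable Cg Ax.
have fi := Cf.2 i; have gi := Cg.2 i.
apply: Cn_ext (CnD (IHn _ _ (CnW Cf) gi) (IHn _ _ (CnW Cg) fi)) => // x Ax.
rewrite deriveM //; apply: diff_derivable.
  exact: Cn_differentiable Cf Ax.
exact: Cn_differentiable Cg Ax.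
Qed.

Lemma CnN n (f : V -> R) : Cn n A f -> Cn n A (fun x => - f x).
Proof.
move=> Cf; have Cm : Cn n A (fun=> -1 : R) by exact: Cn_cst.
apply: Cn_ext (CnM Cm Cf) => // x _.
by rewrite mulN1r.
Qed.

Lemma CnB n (f g : V -> R) :
  Cn n A f -> Cn n A g -> Cn n A (fun x => f x - g x).
Proof. by move=> Cf Cg; apply: CnD => //; exact: CnN. Qed.

Lemma Cn_sum (W : normedModType R) n (I : Type) (r : seq I) (P : pred I)
    (F : I -> V -> W) : (forall i, P i -> Cn n A (F i)) ->
  Cn n A (fun x => \sum_(i <- r | P i) F i x).
Proof.
move=> CF; elim: r => [|i r IHr].
  by apply: Cn_ext (Cn_cst n A 0) => // x _; rewrite big_nil.
have [Pi|Pi] := boolP (P i); last first.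
  by apply: Cn_ext IHr => // x _; rewrite big_cons (negbTE Pi).
by apply: Cn_ext (CnD (CF i Pi) IHr) => // x _; rewrite big_cons Pi.
Qed.

Lemma Cn_prod n (I : Type) (r : seq I) (P : pred I) (F : I -> V -> R) :
  (forall i, P i -> Cn n A (F i)) ->
  Cn n A (fun x => \prod_(i <- r | P i) F i x).
Proof.
move=> CF; elim: r => [|i r IHr].
  have C1 : Cn n A (fun=> 1 : R) by exact: Cn_cst.
  by apply: Cn_ext C1 => // x _; rewrite big_nil.
have [Pi|Pi] := boolP (P i); last first.
  by apply: Cn_ext IHr => // x _; rewrite big_cons (negbTE Pi).
by apply: Cn_ext (CnM (CF i Pi) IHr) => // x _; rewrite big_cons Pi.
Qed.

Lemma CnX n (f : V -> R) m : Cn n A f -> Cn n A (fun x => f x ^+ m).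
Proof.
move=> Cf; elim: m => [|m IHm].
  have C1 : Cn n A (fun=> 1 : R) by exact: Cn_cst.
  by apply: Cn_ext C1 => // x _; rewrite expr0.
by apply: Cn_ext (CnM Cf IHm) => // x _; rewrite exprS.
Qed.

(** The derivative - f' (1/f)^2 contains 1/f again, at the lower order covered by the induction
    hypothesis. *)
Lemma CnV n (f : V -> R) : (forall x, A x -> f x != 0) ->
  Cn n A f -> Cn n A (fun x => (f x)^-1).
Proof.
move=> f0; elim: n => [|n IHn] Cf.
  by move=> x Ax; apply: differentiableV; [exact: Cf|exact: f0].
have df x : A x -> differentiable f x by exact: (Cn_differentiable Cf).
split=> [x Ax|i]; first by apply: differentiableV; [exact: df|exact: f0].
have fV := IHn (CnW Cf).
apply: Cn_ext (CnN (CnM (CnM fV fV) (Cf.2 i))) => // x Ax.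
rewrite deriveV ?f0 //; last exact/diff_derivable/df.
by rewrite -[_ *: _]/(_ * _) expr2 invfM mulNr.
Qed.

Lemma differentiable_sqrt (a : R) : 0 < a -> differentiable (Num.sqrt : R -> R) a.
Proof. by move=> a0; apply/derivable1_diffP; have [] := is_derive1_sqrt a0. Qed.

Lemma derive_comp1 (phi : R -> R) (f : V -> R) x v :
  differentiable phi (f x) -> differentiable f x ->
  'D_v (phi \o f) x = 'D_v f x * 'D_1 phi (f x).
Proof.
move=> dphi df; rewrite (deriveE _ (differentiable_comp df dphi)).
rewrite diff_comp //= !deriveE //.
rewrite -[in LHS](mulr1 ('d f x v)) -[_ * 1]/(_ *: (1 : R)).
by rewrite linearZ.
Qed.

Lemma derive_sqrt_comp (f : V -> R) x v : 0 < f x -> differentiable f x ->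
  'D_v (fun z => Num.sqrt (f z)) x = 'D_v f x * (2 * Num.sqrt (f x))^-1.
Proof.
move=> f0 df; rewrite (derive_comp1 _ (differentiable_sqrt f0)) //.
by rewrite derive_sqrt.
Qed.

(** As for the inverse, the derivative f' / (2 sqrt f) contains the square root at the order of the
    induction hypothesis. *)
Lemma Cn_sqrt n (f : V -> R) : (forall x, A x -> 0 < f x) ->
  Cn n A f -> Cn n A (fun x => Num.sqrt (f x)).
Proof.
move=> f0; elim: n => [|n IHn] Cf.
  move=> x Ax; apply: (@differentiable_comp _ _ _ _ f Num.sqrt); first exact: Cf.
  exact/differentiable_sqrt/f0.
have df x : A x -> differentiable f x by exact: (Cn_differentiable Cf).
split=> [x Ax|i].
  apply: (@differentiable_comp _ _ _ _ f Num.sqrt); first exact: df.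
  exact/differentiable_sqrt/f0.
have s0 x : A x -> 2 * Num.sqrt (f x) != 0.
  by move=> Ax; rewrite mulf_neq0 ?gt_eqF ?sqrtr_gt0 ?f0.
have C2 : Cn n A (fun=> 2 : R) by exact: Cn_cst.
have sV := CnV s0 (CnM C2 (IHn (CnW Cf))).
apply: Cn_ext (CnM (Cf.2 i) sV) => // x Ax.
apply/esym; apply: derive_sqrt_comp; [exact: f0|exact: df].
Qed.

(** Away from zeros, |f| is the square root of the positive function f^2. *)
Lemma Cn_norm n (f : V -> R) : (forall x, A x -> f x != 0) ->
  Cn n A f -> Cn n A (fun x => `|f x|).
Proof.
move=> f0 Cf; have f2 x : A x -> 0 < f x ^+ 2.
  by move=> Ax; rewrite exprn_even_gt0 /= ?f0.
by apply: Cn_ext (Cn_sqrt f2 (CnX 2 Cf)) => // x _; rewrite sqrtr_sqr.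
Qed.

Lemma Cn_coord n m (F : V -> 'rV[R]_m) j :
  Cn n A F -> Cn n A (fun x => F x 0 j).
Proof.
elim: n F => [|n IHn] F /=.
  by move=> dF x Ax; apply: differentiable_mx_coord; exact: dF.
move=> [dF HF]; split=> [x Ax|i].
  by apply: differentiable_mx_coord; exact: dF.
apply: Cn_ext (IHn _ (HF i)) => // x Ax.
by rewrite derive_coord //; exact/diff_derivable/dF.
Qed.

Lemma Cn_row n m (F : V -> 'rV[R]_m) :
  (forall j, Cn n A (fun x => F x 0 j)) -> Cn n A F.
Proof.
move=> CF; suff -> : F = fun x => \sum_j F x 0 j *: 'e_j.
  by apply: Cn_sum => j _; exact: CnZl.
by apply/funext => x; exact: row_sum_delta.
Qed.

Lemma Cn_id n : Cn n A id.
Proof.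
case: n => [|n]; first by move=> x _; exact: ex_diff.
split=> [x _|i]; first exact: ex_diff.
apply: Cn_ext (Cn_cst n A 'e_i) => // x _; by rewrite derive_id.
Qed.

Lemma Cn_det n m (F : V -> 'M[R]_m) : (forall i j, Cn n A (fun x => F x i j)) ->
  Cn n A (fun x => \det (F x)).
Proof.
move=> CF; rewrite /determinant; apply: Cn_sum => s _.
by apply: CnM; [exact: Cn_cst|apply: Cn_prod].
Qed.

End closure.

Lemma derive_comp (W : normedModType R) (U : normedModType R) (v : U -> V) (f : V -> W) x w :
  differentiable v x -> differentiable f (v x) ->
  'D_w (f \o v) x = 'D_('D_w v x) f (v x).
Proof.
by move=> dv df; rewrite (deriveE _ (differentiable_comp dv df)) diff_comp //= !deriveE.
Qed.

Lemma deriveE_partial (W : normedModType R) (f : V -> W) x (w : V) :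
  differentiable f x -> 'D_w f x = \sum_j w 0 j *: 'D_('e_j) f x.
Proof.
move=> df; rewrite deriveE // [in LHS](row_sum_delta w) linear_sum /=.
by apply: eq_bigr => j _; rewrite linearZ deriveE.
Qed.

(** In coordinates the chain rule gives a sum of products of a coordinate of a derivative of [v]
    with a partial derivative of [f] composed with [v]; the induction hypothesis applies to the
    latter. *)
Lemma Cn_comp n (A B : set V) (v : V -> V) (f : V -> R) : open A ->
  (forall x, A x -> B (v x)) -> Cn n A v -> Cn n B f -> Cn n A (f \o v).
Proof.
move=> oA vAB; elim: n f => [|n IHn] f Cv Cf.
  by move=> x Ax; apply: differentiable_comp; [exact: Cv|exact/Cf/vAB].
have dv x : A x -> differentiable v x by exact: (Cn_differentiable Cv).
have df x : A x -> differentiable f (v x).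
  by move=> Ax; exact: Cn_differentiable Cf (vAB _ Ax).
split=> [x Ax|i]; first by apply: differentiable_comp; [exact: dv|exact: df].
have S : Cn n A (fun x => \sum_j ('D_('e_i) v x) 0 j * ('D_('e_j) f \o v) x).
  apply: Cn_sum => // j _; apply: CnM => //.
    by apply: Cn_coord => //; exact: Cv.2.
  by apply: IHn; [exact: CnW|exact: Cf.2].
apply: Cn_ext S => // x Ax.
by rewrite (derive_comp _ (dv _ Ax) (df _ Ax)) (deriveE_partial _ (df _ Ax)).
Qed.

End smoothness.

(** * Vector algebra *)

Section vector_algebra.
Variable R : realType.
Implicit Types (x y z a b c : 'rV[R]_3) (B : 'M[R]_3).

Lemma ord3P (P : 'I_3 -> Prop) : P 0 -> P 1 -> P 2%:R -> forall i, P i.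
Proof.
by move=> P0 P1 P2 [[|[|[|//]]] i3]; [move: P0|move: P1|move: P2];
  congr P; apply/val_inj.
Qed.

Lemma sum3E (W : nmodType) (F : 'I_3 -> W) : \sum_(i < 3) F i = F 0 + F 1 + F 2%:R.
Proof.
rewrite !big_ord_recl big_ord0 addr0 addrA.
by congr (_ + _ + _); congr F; apply/val_inj.
Qed.

Lemma crosspE x y :
  (crossp x y 0 0 = x 0 1 * y 0 2%:R - x 0 2%:R * y 0 1) *
  (crossp x y 0 1 = x 0 2%:R * y 0 0 - x 0 0 * y 0 2%:R) *
  (crossp x y 0 2%:R = x 0 0 * y 0 1 - x 0 1 * y 0 0).
Proof.
have e1 : 0 + 1 = 1 :> 'I_3 by apply/val_inj.
have e2 : 0 + 2%:R = 2%:R :> 'I_3 by apply/val_inj.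
have e3 : 1 + 1 = 2%:R :> 'I_3 by apply/val_inj.
have e4 : 1 + 2%:R = 0 :> 'I_3 by apply/val_inj.
have e5 : 2%:R + 1 = 0 :> 'I_3 by apply/val_inj.
have e6 : 2%:R + 2%:R = 1 :> 'I_3 by apply/val_inj.
by rewrite !mxE e1 e2 e4 e5 e6 e3.
Qed.

Lemma det2E (M : 'M[R]_2) : \det M = M 0 0 * M 1 1 - M 0 1 * M 1 0.
Proof.
have l0 : lift 0 (0 : 'I_1) = 1 :> 'I_2 by apply/val_inj.
have l1 : lift 1 (0 : 'I_1) = 0 :> 'I_2 by apply/val_inj.
rewrite (expand_det_row _ 0) !big_ord_recl big_ord0 /cofactor !det_mx11 !mxE.
rewrite !l0 !l1 /=; ring.
Qed.

Lemma det3E B : \det B =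
  B 0 0 * (B 1 1 * B 2%:R 2%:R - B 1 2%:R * B 2%:R 1)
  - B 0 1 * (B 1 0 * B 2%:R 2%:R - B 1 2%:R * B 2%:R 0)
  + B 0 2%:R * (B 1 0 * B 2%:R 1 - B 1 1 * B 2%:R 0).
Proof.
have lft (i j : 'I_3) (k : 'I_2) : bump i k = j -> lift i k = j.
  by move=> e; apply/val_inj.
have l00 := lft 0 1 0 erefl; have l01 := lft 0 2%:R 1 erefl.
have l10 := lft 1 0 0 erefl; have l11 := lft 1 2%:R 1 erefl.
have l20 := lft 2%:R 0 0 erefl; have l21 := lft 2%:R 1 1 erefl.
rewrite (expand_det_row _ 0) sum3E /cofactor !det2E !mxE.
rewrite l00 l01 l10 l11 l20 l21 /=; ring.
Qed.

(** Vectors are rows, so [B] acts on the right. The left factor is a x b times the cofactor matrix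
    of [B], and the cofactor matrix times [B^T] is [\det B] times the identity. *)
Lemma crossp_mulmx a b B :
  crossp (a *m B) (b *m B) *m B^T = \det B *: crossp a b.
Proof.
apply/rowP; elim/ord3P; rewrite [LHS]mxE sum3E [RHS]mxE !crosspE det3E !mxE !sum3E;
  ring.
Qed.

(** The triple product expansion, used to show that a vector orthogonal to a tangent pair is
    parallel to its cross product. *)
Lemma crosspA a b c : crossp a (crossp b c) = dotp a c *: b - dotp a b *: c.
Proof.
apply/rowP; elim/ord3P; rewrite !crosspE !mxE /dotp !sum3E; ring.
Qed.

Lemma dotpC x y : dotp x y = dotp y x.
Proof. by rewrite /dotp; apply: eq_bigr => i _; rewrite mulrC. Qed.

Lemma dotpZl k x y : dotp (k *: x) y = k * dotp x y.
Proof. by rewrite /dotp mulr_sumr; apply: eq_bigr => i _; rewrite mxE mulrA. Qed.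

Lemma dotpZr k x y : dotp x (k *: y) = k * dotp x y.
Proof. by rewrite dotpC dotpZl dotpC. Qed.

Lemma dotp_ge0 x : 0 <= dotp x x.
Proof. by apply: sumr_ge0 => i _; rewrite -expr2 sqr_ge0. Qed.

Lemma dotp_eq0 x : (dotp x x == 0) = (x == 0).
Proof.
apply/eqP/eqP => [|->]; last first.
  by rewrite /dotp big1 // => i _; rewrite mxE mul0r.
move=> /eqP; rewrite psumr_eq0 => [/allP x0|i _]; last by rewrite -expr2 sqr_ge0.
apply/rowP => i; have := x0 i (mem_index_enum i).
by rewrite /= -expr2 sqrf_eq0 => /eqP ->; rewrite mxE.
Qed.

Lemma enorm_ge0 x : 0 <= enorm x. Proof. exact: sqrtr_ge0. Qed.

Lemma sqr_enorm x : enorm x ^+ 2 = dotp x x.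
Proof. by rewrite sqr_sqrtr // dotp_ge0. Qed.

Lemma enorm_eq0 x : (enorm x == 0) = (x == 0).
Proof. by rewrite -sqrf_eq0 sqr_enorm dotp_eq0. Qed.

Lemma enorm_gt0 x : (0 < enorm x) = (x != 0).
Proof. by rewrite lt_neqAle enorm_ge0 andbT eq_sym enorm_eq0. Qed.

Lemma enormZ k x : enorm (k *: x) = `|k| * enorm x.
Proof.
by rewrite /enorm dotpZl dotpZr mulrA -expr2 sqrtrM ?sqr_ge0 // sqrtr_sqr.
Qed.

(** Lagrange's identity. *)
Lemma sqr_enorm_crossp x y :
  enorm (crossp x y) ^+ 2 = dotp x x * dotp y y - dotp x y ^+ 2.
Proof. rewrite sqr_enorm /dotp !sum3E !crosspE; ring. Qed.

Lemma crossp_neq0_mulmx a b B : \det B != 0 -> crossp a b != 0 ->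
  crossp (a *m B) (b *m B) != 0.
Proof.
move=> B0; apply: contra_neq => ab0.
have := crossp_mulmx a b B; rewrite ab0 mul0mx => /esym/eqP.
by rewrite scaler_eq0 (negbTE B0) => /eqP.
Qed.

(* g and h are the gradients of two functions related by the substitution
   with Jacobian matrix B, and a, b are tangent to the level set of the first. *)
Lemma enorm_crossp_mulmx a b g h B : g = h *m B^T -> \det B != 0 -> g != 0 ->
  dotp a g = 0 -> dotp b g = 0 ->
  enorm (crossp (a *m B) (b *m B)) =
  `|\det B| * enorm h / enorm g * enorm (crossp a b).
Proof.
move=> gh B0 g0 ag bg; set n := crossp a b.
have gg0 : dotp g g != 0 by rewrite dotp_eq0.
pose l := dotp g n / dotp g g.
(* Since [a] and [b] are orthogonal to [g], the expansion of g x (a x b) vanishes; expanding g x (g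
   x n) = 0 then shows that [n] is its own projection on [g]. *)
have ng : n = l *: g.
  have : crossp g (crossp g n) = 0.
    have -> : crossp g n = 0.
      by rewrite /n crosspA ![dotp g _]dotpC ag bg !scale0r subrr.
    by apply/rowP; elim/ord3P; rewrite crosspE !mxE; ring.
  rewrite crosspA => /eqP; rewrite subr_eq0 => /eqP E.
  by rewrite /l mulrC -scalerA E scalerA mulVf ?scale1r.
have Bu : B^T \in unitmx by rewrite unitmx_tr unitmxE unitfE.
(* Both sides agree after multiplication by the invertible matrix [B^T], by the cofactor identity
   and [gh]. *)
have -> : crossp (a *m B) (b *m B) = (\det B * l) *: h.
  apply: (can_inj (mulmxK Bu)).
  by rewrite crossp_mulmx -/n ng -scalemxAl -gh scalerA.
rewrite ng !enormZ normrM -!mulrA; congr (_ * _).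
rewrite (mulrCA _ `|l|) mulVf ?mulr1 ?enorm_eq0 // mulrC //.
Qed.

End vector_algebra.

(** * Measures with a density *)

Section density.
Local Open Scope ereal_scope.
Context d (T : measurableType d) (R : realType).
Implicit Types (m mu nu : {measure set T -> \bar R}) (D E A : set T).

Import HBNNSimple.

(** Both integrals are suprema over the nonnegative simple functions below the extension of [f] by
    zero. A nonzero level set of such a function lies in [E], where the two measures are
    comparable. *)
Lemma ge0_le_measure_integral_on m1 m2 E (f : T -> \bar R) :
  (forall x, E x -> 0 <= f x) ->
  (forall A, measurable A -> A `<=` E -> m1 A <= m2 A) ->
  \int[m1]_(x in E) f x <= \int[m2]_(x in E) f x.
Proof.
move=> f0 m12; rewrite !ge0_integralE // ge_ereal_sup // => _ [h /= hf] <-.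
apply: le_ereal_sup_tmp; exists (sintegral m2 h); first by exists h.
rewrite !sintegralE lee_fsum // => r [t _ <-].
have [->|h0] := eqVneq (h t) 0%R; first by rewrite !mul0e.
rewrite lee_pmul ?lee_fin // m12 // => x /= hx.
apply: contrapT => /mem_set Ex; have := hf x.
rewrite patchN; last by rewrite inE in Ex; rewrite notin_setE.
by rewrite hx lee_fin leNgt lt_neqAle eq_sym h0 /=; case/negP.
Qed.

Lemma ge0_integral_le_scale m1 m2 E (f : T -> \bar R) (a : R) :
  measurable E -> measurable_fun E f -> (forall x, E x -> 0 <= f x) ->
  (0 <= a)%R ->
  (forall A, measurable A -> A `<=` E -> m1 A <= a%:E * m2 A) ->
  \int[m1]_(x in E) f x <= a%:E * \int[m2]_(x in E) f x.
Proof.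
move=> mE mf f0 a0 m12.
have := ge0_integral_mscale m2 mE (NngNum a0) mf f0 => /= <-.
exact: ge0_le_measure_integral_on.
Qed.

Variables (mu nu : {measure set T -> \bar R}) (D : set T) (J : T -> R).
Hypothesis mD : measurable D.
Hypothesis mJ : measurable_fun D J.
Hypothesis J0 : forall x, D x -> (0 < J x)%R.
Hypothesis nu_le : forall A a, measurable A -> A `<=` D -> (0 < a)%R ->
  (forall x, A x -> (J x <= a)%R) -> nu A <= a%:E * mu A.
Hypothesis nu_ge : forall A a, measurable A -> A `<=` D -> (0 < a)%R ->
  (forall x, A x -> (a <= J x)%R) -> a%:E * mu A <= nu A.

(** With r = exp(-e), the pieces collect the points where ln J / e has a given integer part i, so
    that J lies between exp(i e) and exp((i + 1) e) there. *)
Lemma geometric_partition (r : R) : (0 < r < 1)%R ->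
  exists (F : (set T)^nat) (b : nat -> R),
    [/\ forall n, measurable (F n), trivIset setT F, D = \bigcup_n F n,
        forall n, (0 < b n)%R &
        forall n x, F n x -> (r * b n <= J x <= b n)%R].
Proof.
move=> /andP[r0 r1]; pose e := (- ln r)%R.
have e0 : (0 < e)%R by rewrite oppr_gt0 ln_lt0 // r0.
pose q x := Num.floor (ln (J x) / e)%R.
(* The integers are enumerated by their codes. An index that codes no integer gets the empty piece
   and the arbitrary positive bound 1. *)
pose F n := if @pickle_inv int n is Some i then D `&` [set x | q x = i] else set0.
pose b n := if @pickle_inv int n is Some i then expR ((i + 1)%:~R * e)%R else 1%R.
have lnb (x : T) (i : int) : D x -> q x = i ->
    (i%:~R * e <= ln (J x) < (i + 1)%:~R * e)%R.
  move=> Dx qx; rewrite -ler_pdivlMr // -ltr_pdivrMr // -qx.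
  by rewrite floor_le_tmp lt_succ_floor.
exists F, b; split => [n||||n x].
- rewrite /F; case: pickle_inv => // i.
  have -> : D `&` [set x | q x = i] =
      D `&` (fun x => ln (J x)) @^-1` `[(i%:~R * e)%R, ((i + 1)%:~R * e)%R[.
    apply/seteqP; split => x /= [Dx qx]; split => //.
      by rewrite in_itv /=; exact: lnb.
    move: qx; rewrite in_itv /= -ler_pdivlMr // -ltr_pdivrMr // => qx.
    exact: floor_def.
  have mln : measurable_fun D (fun x => ln (J x)).
    by apply: (measurableT_comp (@measurable_ln R)).
  exact: mln.
- apply/trivIsetP => n m _ _ nm; rewrite -subset0 => x [].
  rewrite /F; case En: (@pickle_inv int n) => [i|//]; case Em: (@pickle_inv int m) => [j|//].
  move=> [_ /= qi] [_ /= qj]; move/eqP: nm; apply.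
  have := @pickle_invK int n; have := @pickle_invK int m.
  by rewrite En Em /= -qi -qj => -> ->.
- apply/seteqP; split => x.
    by move=> Dx; exists (pickle (q x)); [exact: I|rewrite /F pickleK_inv].
  by move=> [n _]; rewrite /F; case: pickle_inv => // i [].
- by move=> n; rewrite /b; case: pickle_inv => [i|//]; exact: expR_gt0.
- rewrite /F /b; case: pickle_inv => // i [Dx /= qx].
  have /andP[l1 l2] := lnb _ _ Dx qx.
  rewrite -[J x]lnK ?posrE ?J0 //.
  rewrite -{1}[r]lnK ?posrE // -expRD !ler_expR (ltW l2) andbT.
  by apply: le_trans l1; rewrite intrD /e; lra.
Qed.

(** On each piece of the geometric partition, both [nu] and the measure with density [J] lie between
    r b and b times [mu]. *)
Lemma ge0_integral_density (f : T -> R) :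
  measurable_fun D f -> (forall x, D x -> (0 <= f x)%R) ->
  \int[nu]_(x in D) (f x)%:E = \int[mu]_(x in D) (f x * J x)%:E.
Proof.
move=> mf f0.
have fJ0 x : D x -> (0 <= f x * J x)%R.
  by move=> Dx; rewrite mulr_ge0 ?f0 // ltW // J0.
have mfJ : measurable_fun D (fun x => f x * J x)%R by exact: measurable_funM.
have sub E x : E `<=` D -> E x -> 0 <= (f x)%:E.
  by move=> ED /ED Dx; rewrite lee_fin f0.
(* Letting [r] tend to 1 gives both inequalities, also when the integrals are infinite. *)
suff H r : (0 < r < 1)%R ->
    r%:E * \int[nu]_(x in D) (f x)%:E <= \int[mu]_(x in D) (f x * J x)%:E /\
    r%:E * \int[mu]_(x in D) (f x * J x)%:E <= \int[nu]_(x in D) (f x)%:E.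
  apply/eqP; rewrite eq_le; apply/andP; split; apply/lee_mul01Pr.
  - by apply: integral_ge0 => x Dx; rewrite lee_fin f0.
  - by move=> r /H[].
  - by apply: integral_ge0 => x Dx; rewrite lee_fin fJ0.
  - by move=> r /H[].
move=> r01; have /andP[r0 r1] := r01.
have [F [b [mF tF DF b0 Fb]]] := geometric_partition r01.
have FD n : F n `<=` D by rewrite DF; exact: bigcup_sup.
have mfn n : measurable_fun (F n) (EFin \o f).
  by apply/measurable_EFinP; exact: measurable_funS mf.
have mfJn n : measurable_fun (F n) (fun x => (f x * J x)%:E).
  by apply/measurable_EFinP; exact: measurable_funS mfJ.
have -> : \int[nu]_(x in D) (f x)%:E =
    \sum_(0 <= n <oo) \int[nu]_(x in F n) (f x)%:E.
  rewrite DF ge0_integral_bigcup // -DF; first exact/measurable_EFinP.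
  by move=> x Dx; rewrite lee_fin f0.
have -> : \int[mu]_(x in D) (f x * J x)%:E =
    \sum_(0 <= n <oo) \int[mu]_(x in F n) (f x * J x)%:E.
  rewrite DF ge0_integral_bigcup // -DF; first exact/measurable_EFinP.
  by move=> x Dx; rewrite lee_fin fJ0.
have nn n : 0 <= \int[nu]_(x in F n) (f x)%:E.
  by apply: integral_ge0 => x /FD Dx; rewrite lee_fin f0.
have mn n : 0 <= \int[mu]_(x in F n) (f x * J x)%:E.
  by apply: integral_ge0 => x /FD Dx; rewrite lee_fin fJ0.
rewrite -!nneseriesZl //; split; apply: lee_nneseries => n _;
  rewrite ?mule_ge0 ?lee_fin ?(ltW r0) //.
(* First [nu] is at most b [mu] on the piece, since J is at most b; then r b is at most J. *)
- apply: (@le_trans _ _ (r%:E * ((b n)%:E * \int[mu]_(x in F n) (f x)%:E))).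
    rewrite lee_pmul2l // ?lte_fin //.
    apply: ge0_integral_le_scale => //; [move=> x; apply: sub; exact: FD|exact/ltW/b0|].
    move=> A mA AF; apply: nu_le => //; first exact: subset_trans (FD n).
    by move=> x /AF /Fb/andP[].
  rewrite muleA -EFinM -ge0_integralZl //; last 2 first.
  - move=> x; apply: sub; exact: FD.
  - by rewrite lee_fin mulr_ge0 // ltW.
  apply: ge0_le_integral => //.
  + move=> x Fx; rewrite mule_ge0 ?lee_fin ?f0 ?mulr_ge0 ?(ltW (b0 _)) ?(ltW r0) //.
    exact: FD Fx.
  + exact: emeasurable_funM.
  + move=> x Fx; rewrite -EFinM lee_fin mulrC ler_wpM2l ?f0 //; first exact: FD Fx.
    by have /andP[] := Fb _ _ Fx.
(* Conversely J is at most b; then r b [mu] is at most [nu], since J is at least r b. *)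
- apply: (@le_trans _ _ ((r * b n)%:E * \int[mu]_(x in F n) (f x)%:E)).
    rewrite -!ge0_integralZl //; last 4 first.
    - move=> x; apply: sub; exact: FD.
    - by rewrite lee_fin mulr_ge0 // ltW.
    - by move=> x /FD Dx; rewrite lee_fin fJ0.
    - by rewrite lee_fin ltW.
    apply: ge0_le_integral => //.
    + by move=> x /FD Dx; rewrite mule_ge0 ?lee_fin ?fJ0 ?(ltW r0).
    + exact: emeasurable_funM.
    + exact: emeasurable_funM.
    + move=> x Fx; have Dx := FD _ _ Fx.
      rewrite -!EFinM lee_fin -mulrA ler_pM2l // mulrC ler_wpM2r ?f0 //.
      by have /andP[] := Fb _ _ Fx.
  rewrite -lee_pdivlMl ?mulr_gt0 //.
  apply: ge0_integral_le_scale => //.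
  - by move=> x; apply: sub; exact: FD.
  - by rewrite invr_ge0 mulr_ge0 // ltW.
  move=> A mA AF; rewrite lee_pdivlMl ?mulr_gt0 //; apply: nu_ge => //.
  - exact: subset_trans (FD n).
  - by rewrite mulr_gt0.
  - by move=> x /AF /Fb/andP[].
Qed.

(** Multiplication by the positive [J] commutes with taking positive and negative parts. *)
Lemma integral_density (f : T -> R) : measurable_fun D f ->
  \int[nu]_(x in D) (f x)%:E = \int[mu]_(x in D) (f x * J x)%:E.
Proof.
move=> mf; rewrite integralE [RHS]integralE; congr (_ - _).
- transitivity (\int[nu]_(x in D) (Num.max (f x) 0)%:E).
    by apply: eq_integral => x _; rewrite funeposE EFin_max.
  rewrite ge0_integral_density; last 2 first.
  - by apply: measurable_maxr.
  - by move=> x _; rewrite le_max lexx orbT.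
  apply: eq_integral => x /[!inE] Dx.
  by rewrite funeposE -EFin_max maxr_pMl ?mul0r ?(ltW (J0 Dx)).
- transitivity (\int[nu]_(x in D) (Num.max (- f x) 0)%:E).
    by apply: eq_integral => x _; rewrite funenegE EFin_max.
  rewrite ge0_integral_density; last 2 first.
  - by apply: measurable_maxr => //; exact: measurableT_comp.
  - by move=> x _; rewrite le_max lexx orbT.
  apply: eq_integral => x /[!inE] Dx.
  by rewrite funenegE -EFinN -EFin_max -mulNr maxr_pMl ?mul0r ?(ltW (J0 Dx)).
Qed.

End density.

(** * Change of variables along a measurable map *)

Section change_of_variables.
Local Open Scope ereal_scope.
Context d1 d2 (X : measurableType d1) (Y : measurableType d2) (R : realType).
Variables (phi : X -> Y) (mphi : measurable_fun setT phi).
Variables (mu : {measure set X -> \bar R}) (nu : {measure set Y -> \bar R}).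
Variables (D : set Y) (J : Y -> R).
Hypothesis mD : measurable D.
Hypothesis mJ : measurable_fun D J.
Hypothesis J0 : forall y, D y -> (0 < J y)%R.
Hypothesis nu_le : forall (A : set Y) (a : R), measurable A -> A `<=` D ->
  (0 < a)%R -> (forall y, A y -> (J y <= a)%R) -> nu A <= a%:E * mu (phi @^-1` A).
Hypothesis nu_ge : forall (A : set Y) (a : R), measurable A -> A `<=` D ->
  (0 < a)%R -> (forall y, A y -> (a <= J y)%R) -> a%:E * mu (phi @^-1` A) <= nu A.

(** The density formula is applied to the pushforward of [mu] by [phi], and the integral is then
    pulled back separately for the positive and the negative part. *)
Lemma integral_change_of_variables (f : Y -> R) : measurable_fun D f ->
  \int[nu]_(y in D) (f y)%:E =
  \int[mu]_(x in phi @^-1` D) (f (phi x) * J (phi x))%:E.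
Proof.
move=> mf; pose mu' : {measure set Y -> \bar R} := pushforward mu phi.
rewrite (integral_density (mu := mu' mphi) mD mJ J0) //.
have mfJ : measurable_fun D (EFin \o (fun y => f y * J y)%R).
  by apply/measurable_EFinP; exact: measurable_funM.
rewrite integralE [RHS]integralE; congr (_ - _).
- rewrite (ge0_integral_pushforward mphi) //; last exact: measurable_funepos.
  by apply: eq_integral => x _; rewrite /= !funeposE.
- rewrite (ge0_integral_pushforward mphi) //; last exact: measurable_funeneg.
  by apply: eq_integral => x _; rewrite /= !funenegE.
Qed.

End change_of_variables.

(** * Surface measure *)

Lemma open_setI_preimage (X Y : topologicalType) (U : set X) (O : set Y)
    (f : X -> Y) : open U -> (forall x, U x -> {for x, continuous f}) ->
  open O -> open (U `&` f @^-1` O).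
Proof.
move=> oU cf oO; rewrite openE => x [Ux Ofx]; rewrite /interior.
apply: filterI; first exact: (open_nbhs_nbhs (conj oU Ux)).
by apply: (cf _ Ux); exact: (open_nbhs_nbhs (conj oO Ofx)).
Qed.

(** * Borel measurability of continuous maps *)

Section borel.
Variable R : realType.

(** An open set of the plane is the countable union of the products of rational balls that it
    contains. Products not contained in it are replaced by the empty set. *)
Lemma open_measurable_prod (U : set (R * R)) : open U -> measurable U.
Proof.
move=> oU.
pose B (q : rat * rat * (rat * rat)) : set (R * R) :=
  ball (ratr q.1.1 : R) (ratr q.1.2) `*` ball (ratr q.2.1 : R) (ratr q.2.2).
have -> : U = \bigcup_q (if pselect (B q `<=` U) then B q else set0).
  apply/seteqP; split => [[x y] Uxy|z [q _]]; last by case: pselect => [BU /BU|_ []].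
  have := open_nbhs_nbhs (conj oU Uxy) => -[[P Q] /= [Px Qy] PQ].
  move: Px Qy; rewrite /= !nbhsE => -[P' [oP P'x] P'P] [Q' [oQ Q'y] Q'Q].
  have [c [r]] := open_subball_rat oP (mem_set P'x).
  move=> [/set_mem cx cP].
  have [c' [r']] := open_subball_rat oQ (mem_set Q'y).
  move=> [/set_mem cy cQ].
  exists ((c, r), (c', r')) => //; case: pselect => //= -[].
  by move=> [a b] /= [/cP/P'P Pa /cQ/Q'Q Qb]; exact: (PQ (a, b)).
apply: countable_bigcupT_measurable => [|q]; first exact: countableP.
case: pselect => //= _.
by apply: measurableX; apply: open_measurable; exact: ball_open.
Qed.

Lemma open_measurable_borel3 (A : set 'rV[R]_3) :
  open A -> measurable (A : set (borel3 R)).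
Proof. by move=> oA; exact: sub_sigma_algebra. Qed.

Lemma continuous_measurable_prod_borel3 (U : set (R * R))
    (psi : R * R -> 'rV[R]_3) : open U ->
  (forall u, U u -> {for u, continuous psi}) ->
  measurable_fun U (psi : R * R -> borel3 R).
Proof.
move=> oU cpsi.
apply: (@measurability _ _ _ (borel3 R) U psi (@open 'rV[R]_3)) => //.
move=> _ [Z oZ <-]; apply: open_measurable_prod.
exact: open_setI_preimage.
Qed.

Lemma continuous_measurable_prod_real (U : set (R * R)) (f : R * R -> R) :
  open U -> (forall u, U u -> {for u, continuous f}) -> measurable_fun U f.
Proof.
move=> oU cf; apply: (measurability _ (RGenOpens.measurableE R)).
move=> _ [_ [a [b ->] <-]]; apply: open_measurable_prod.
by apply: open_setI_preimage => //; exact: interval_open.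
Qed.

Lemma continuous_measurable_borel3_real (U : set 'rV[R]_3) (f : 'rV[R]_3 -> R) :
  open U -> (forall u, U u -> {for u, continuous f}) ->
  measurable_fun (U : set (borel3 R)) f.
Proof.
move=> oU cf; apply: (measurability _ (RGenOpens.measurableE R)).
move=> _ [_ [a [b ->] <-]]; apply: open_measurable_borel3.
by apply: open_setI_preimage => //; exact: interval_open.
Qed.

Lemma continuous_measurable_borel3 (f : 'rV[R]_3 -> 'rV[R]_3) :
  continuous f -> measurable_fun setT (f : borel3 R -> borel3 R).
Proof.
move=> cf.
apply: (@measurability _ _ (borel3 R) (borel3 R) setT f (@open 'rV[R]_3)) => //.
move=> _ [Z oZ <-]; apply: open_measurable_borel3.
by apply: open_setI_preimage => //; [exact: openT|move=> x _; exact: cf].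
Qed.

End borel.

Section patch.
Variable R : realType.
Local Notation V := 'rV[R]_3.
Local Notation leb2 := (@lebesgue_measure R \x @lebesgue_measure R)%E.
Implicit Types (M : set V) (U K : set (R * R)) (psi : R * R -> V).

Lemma continuous_enorm_crossp (F G : R * R -> V) (u : R * R) :
  {for u, continuous F} -> {for u, continuous G} ->
  {for u, continuous (fun w => enorm (crossp (F w) (G w)))}.
Proof.
move=> cF cG.
have cFi i : {for u, continuous (fun w => F w 0 i)}.
  by apply: (@continuous_comp _ _ _ F (fun x : V => x 0 i)) => //; exact: coord_continuous.
have cGi i : {for u, continuous (fun w => G w 0 i)}.
  by apply: (@continuous_comp _ _ _ G (fun x : V => x 0 i)) => //; exact: coord_continuous.
apply: (@continuous_comp _ _ _ _ (@Num.sqrt R)); last exact: sqrt_continuous.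
have cc i : {for u, continuous (fun w => crossp (F w) (G w) 0 i)}.
  have -> : (fun w => crossp (F w) (G w) 0 i) =
     (fun w => F w 0 (i + 1) * G w 0 (i + 2%:R) - F w 0 (i + 2%:R) * G w 0 (i + 1)).
    by apply/funext => w; rewrite mxE.
  by apply: cvgB; apply: cvgM; (exact: cFi || exact: cGi).
have -> : (fun w => dotp (crossp (F w) (G w)) (crossp (F w) (G w))) =
    (fun w => crossp (F w) (G w) 0 0 * crossp (F w) (G w) 0 0
      + crossp (F w) (G w) 0 1 * crossp (F w) (G w) 0 1
      + crossp (F w) (G w) 0 2%:R * crossp (F w) (G w) 0 2%:R).
  by apply/funext => w; rewrite /dotp sum3E.
by do !apply: cvgD; apply: cvgM; exact: cc.
Qed.

Section fixed_patch.
Variables (M : set V) (U : set (R * R)) (psi : R * R -> V).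
Hypothesis Upsi : regular_patch M U psi.

Lemma patch_open : open U. Proof. by case: Upsi. Qed.

Lemma patch_in u : U u -> M (psi u). Proof. by case: Upsi => _ + _ _; exact. Qed.

Lemma patch_differentiable u : U u -> differentiable psi u.
Proof. by case: Upsi => _ _ _ /[apply] -[]. Qed.

Lemma patch_measurable_fun : measurable_fun U (psi : R * R -> borel3 R).
Proof.
apply: continuous_measurable_prod_borel3; first exact: patch_open.
by move=> u Uu; apply: differentiable_continuous; exact: patch_differentiable.
Qed.

(** Pieces of a covering can therefore be cut by Borel sets, which both additivity and the transport
    of surface measure rely on. *)
Lemma measurable_patch_piece K (A : set (borel3 R)) : measurable K -> K `<=` U ->
  measurable A -> measurable (K `&` psi @^-1` A).
Proof.
move=> mK KU mA; rewrite -(setIidl KU) -setIA; apply: measurableI => //.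
by apply: patch_measurable_fun => //; apply: open_measurable_prod; exact: patch_open.
Qed.

Lemma measurable_normal : measurable_fun U (fun u => (enorm (normal psi u))%:E).
Proof.
apply/measurable_EFinP; apply: continuous_measurable_prod_real.
  exact: patch_open.
move=> u Uu; have [_ _ _ /(_ _ Uu)[_ c1 c2 _]] := Upsi.
exact: continuous_enorm_crossp c1 c2.
Qed.

Lemma measurable_normalS K : K `<=` U -> measurable K ->
  measurable_fun K (fun u => (enorm (normal psi u))%:E).
Proof.
move=> KU mK; apply: measurable_funS measurable_normal => //.
apply: open_measurable_prod; exact: patch_open.
Qed.

Lemma le_patch_area K K' : measurable K -> measurable K' -> K' `<=` U ->
  K `<=` K' -> (patch_area psi K <= patch_area psi K')%E.
Proof.
move=> mK mK' K'U KK'; apply: ge0_subset_integral => //.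
  exact: measurable_normalS.
by move=> u _; rewrite lee_fin enorm_ge0.
Qed.

Lemma patch_area_bigcup (F : (set (R * R))^nat) : (forall n, measurable (F n)) ->
  (forall n, F n `<=` U) -> trivIset setT F ->
  patch_area psi (\bigcup_n F n) = (\sum_(0 <= n <oo) patch_area psi (F n))%E.
Proof.
move=> mF FU tF; rewrite /patch_area ge0_integral_bigcup //.
  apply: measurable_normalS; first exact: bigcup_sub.
  exact: bigcupT_measurable.
by move=> u _; rewrite lee_fin enorm_ge0.
Qed.

End fixed_patch.

Lemma le_patch_area_scale M N U psi psi' K (a : R) :
  regular_patch N U psi -> regular_patch M U psi' -> measurable K ->
  K `<=` U -> 0 < a ->
  (forall u, K u -> enorm (normal psi' u) <= a * enorm (normal psi u)) ->
  (patch_area psi' K <= a%:E * patch_area psi K)%E.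
Proof.
move=> Upsi Upsi' mK KU a0 le.
have e0 (f : R * R -> V) u : K u -> (0 <= (enorm (normal f u))%:E)%E.
  by move=> _; rewrite lee_fin enorm_ge0.
have mf := measurable_normalS Upsi KU mK.
have mf' := measurable_normalS Upsi' KU mK.
have a0' : (0 <= a%:E)%E by rewrite lee_fin ltW.
rewrite /patch_area.
have <- := @ge0_integralZl _ _ _ leb2 K mK _ mf a%:E (@e0 psi) a0'.
have maf : measurable_fun K (fun u => a%:E * (enorm (normal psi u))%:E)%E.
  exact: measurable_funeM mf.
apply: (@ge0_le_integral _ _ _ leb2 K mK _ _ (@e0 psi') mf' maf) => u Ku.
by rewrite -EFinM lee_fin le.
Qed.

Lemma patch_area_ge0 psi K : (0 <= patch_area psi K)%E.
Proof. by apply: integral_ge0 => u _; rewrite lee_fin enorm_ge0. Qed.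

Lemma patch_area_set0 psi : patch_area psi set0 = 0%E.
Proof. exact: integral_set0. Qed.

Lemma regular_patch_set0 M psi : regular_patch M set0 psi.
Proof.
by split=> // x y; rewrite in_set0.
Qed.

(** * Countable additivity of surface measure on Borel sets *)

Section surface.
Variables (M : set V).
Implicit Types A : set (borel3 R).
Local Open Scope ereal_scope.

Definition surface_cover (A : set V) (psi : nat -> R * R -> V)
    (U K : nat -> set (R * R)) : Prop :=
  [/\ forall k, regular_patch M (U k) (psi k),
      forall k, measurable (K k) /\ K k `<=` U k &
      A `&` M `<=` \bigcup_k (psi k @` K k)].

Lemma surface_measure_le (A : set V) (psi : nat -> R * R -> V)
    (U K : nat -> set (R * R)) : surface_cover A psi U K ->
  surface_measure M A <= \sum_(0 <= k <oo) patch_area (psi k) (K k).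
Proof.
by move=> [c1 c2 c3]; apply: ereal_inf_lbound; exists psi, U, K.
Qed.

Lemma le_surface_measure (A : set V) (x : \bar R) :
  (forall (psi : nat -> R * R -> V) (U K : nat -> set (R * R)),
    surface_cover A psi U K ->
    x <= \sum_(0 <= k <oo) patch_area (psi k) (K k)) ->
  x <= surface_measure M A.
Proof.
move=> H; apply: le_ereal_inf_tmp => _ [psi [U [K [c1 c2 c3 ->]]]].
exact: H.
Qed.

Lemma surface_measure_ge0 (A : set V) : 0 <= surface_measure M A.
Proof.
by apply: le_surface_measure => psi U K _; apply: nneseries_ge0 => n _ _;
  exact: patch_area_ge0.
Qed.

Lemma surface_measure_set0 : surface_measure M set0 = 0.
Proof.
apply/eqP; rewrite eq_le surface_measure_ge0 andbT.
have c : surface_cover set0 (fun=> cst 0%R) (fun=> set0) (fun=> set0).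
  by split=> [k|k|]; [exact: regular_patch_set0|split|rewrite set0I].
apply: le_trans (surface_measure_le c) _.
by rewrite eseries0 // => k _ _; rewrite patch_area_set0.
Qed.

(** The usual argument for outer measures: nearly optimal coverings of the [A n] are merged into one
    covering of the union. *)
Lemma surface_measure_sigma_subadditive :
  sigma_subadditive (surface_measure M).
Proof.
(* If some term is infinite, so is the series; otherwise every infimum is finite and can be
   approached. *)
move=> A; have [[i ioo]|] := pselect (exists i, surface_measure M (A i) = +oo).
  rewrite (eseries_pinfty _ _ ioo) ?leey // => n _.
  by rewrite -ltNye (lt_le_trans _ (surface_measure_ge0 _)).
rewrite -forallNE => Aoo; apply/lee_addgt0Pr => _/posnumP[e].
apply: le_trans (epsilon_trick _ (fun=> surface_measure_ge0 _) (ltW _)) => //.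
(* The covering chosen for [A n] exceeds its measure by at most e / 2^(n+1), and these errors add up
   to at most e. *)
pose P n (c : (nat -> R * R -> V) * (nat -> set (R * R)) *
    (nat -> set (R * R))) := surface_cover (A n) c.1.1 c.1.2 c.2 /\
  \sum_(0 <= k <oo) patch_area (c.1.1 k) (c.2 k) <=
    surface_measure M (A n) + (e%:num / (2 ^ n.+1)%:R)%:E.
have [G PG] : {G & forall n, P n (G n)}.
  apply: (@choice _ _ P) => n.
  have en : (0 < e%:num / (2 ^ n.+1)%:R :> R)%R by [].
  have fn : surface_measure M (A n) \is a fin_num.
    by rewrite ge0_fin_numE ?surface_measure_ge0 // ltey; exact/eqP/Aoo.
  have [_ [psi [U [K [c1 c2 c3 ->]]]] /ltW le] := lb_ereal_inf_adherent en fn.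
  by exists (psi, U, K); split.
pose a i j := patch_area ((G i).1.1 j) ((G i).2 j).
have a0 i j : 0 <= a i j by exact: patch_area_ge0.
(* A bijection from the naturals to pairs lists the patches of all the coverings in one sequence. *)
have /card_esym/ppcard_eqP[f] := card_nat2.
apply: (@le_trans _ _ (\sum_(0 <= k <oo) a (f k).1 (f k).2)).
  apply: (@surface_measure_le _ (fun k => (G (f k).1).1.1 (f k).2)
    (fun k => (G (f k).1).1.2 (f k).2) (fun k => (G (f k).1).2 (f k).2)).
  split=> [k|k|x [[i _ Aix] Mx]].
  - by have [[]] := PG (f k).1.
  - by have [[]] := PG (f k).1.
  - have [[_ _ cA] _] := PG i; have [j _ ?] := cA _ (conj Aix Mx).
    by exists (f^-1%FUN (i, j)) => //=; rewrite invK ?inE.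
rewrite nneseries_esumT //.
have <- : \esum_(p in setT) a p.1 p.2 = \esum_(k in setT) a (f k).1 (f k).2.
  by apply: (reindex_esum setT setT f).
have -> : \esum_(p in [set: nat * nat]) a p.1 p.2 =
    \sum_(0 <= i <oo) \sum_(0 <= j <oo) a i j.
  rewrite nneseries_esumT; last by move=> i; apply: nneseries_ge0.
  transitivity (\esum_(i in [set: nat]) \esum_(j in [set: nat]) a i j).
    rewrite esum_esum //; congr esum; apply/seteqP; split=> // p _.
  by apply: eq_esum => i _; rewrite nneseries_esumT.
apply: lee_nneseries => [i _ _|i _]; first exact: nneseries_ge0.
by have [] := PG i.
Qed.

(** Cutting a covering of the union by the preimages of the [A n] gives a covering of each [A n].
    For each patch the cut pieces are disjoint, so their areas sum to at most that of the original
    piece. *)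
Lemma surface_measure_bigcup_ge (A : (set (borel3 R))^nat) :
  (forall n, measurable (A n)) -> trivIset setT A ->
  \sum_(0 <= n <oo) surface_measure M (A n) <=
  surface_measure M (\bigcup_n A n).
Proof.
move=> mA tA; apply: le_surface_measure => psi U K [c1 c2 c3].
pose L n k := K k `&` psi k @^-1` A n.
have mL n k : measurable (L n k).
  by have [mK KU] := c2 k; exact: (measurable_patch_piece (c1 k) mK KU (mA n)).
have LU n k : L n k `<=` U k.
  by apply: subset_trans (c2 k).2; exact: subIsetl.
apply: (@le_trans _ _ (\sum_(0 <= n <oo) \sum_(0 <= k <oo)
    patch_area (psi k) (L n k))).
  apply: lee_nneseries => [n _ _|n _]; first exact: surface_measure_ge0.
  apply: surface_measure_le; split=> // x [Anx Mx].
  have [|k _ [u Ku ux]] := c3 x; first by split=> //; exists n.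
  by exists k => //; exists u => //; split=> //=; rewrite ux.
rewrite nneseries_interchange; last by move=> n k; exact: patch_area_ge0.
apply: lee_nneseries => [k _ _|k _].
  by apply: nneseries_ge0 => n _ _; exact: patch_area_ge0.
rewrite -(patch_area_bigcup (c1 k)) //; last first.
  apply/trivIsetP => i j _ _ ij; rewrite -subset0 => u [[_ /= Ai] [_ /= Aj]].
  have /trivIsetP/(_ i j I I ij) Aij0 := tA.
  by have : (A i `&` A j) (psi k u) by []; rewrite Aij0.
have [mK KU] := c2 k.
apply: (le_patch_area (c1 k)) => //; first exact: bigcupT_measurable.
by apply: bigcup_sub => n _; exact: subIsetl.
Qed.

Lemma surface_measure_semi_sigma_additive :
  semi_sigma_additive (surface_measure M : set (borel3 R) -> \bar R).
Proof.
move=> A mA tA mUA.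
have -> : surface_measure M (\bigcup_n A n) =
    \sum_(0 <= n <oo) surface_measure M (A n).
  apply/eqP; rewrite eq_le surface_measure_sigma_subadditive /=.
  exact: surface_measure_bigcup_ge.
by apply: is_cvg_nneseries => n _ _; exact: surface_measure_ge0.
Qed.

(** This makes the outer measure a measure on [borel3], so that the results on densities apply to
    surface integrals. *)
HB.instance Definition _ := isMeasure.Build _ (borel3 R) R
  (surface_measure M : set (borel3 R) -> \bar R)
  surface_measure_set0 surface_measure_ge0 surface_measure_semi_sigma_additive.

End surface.

(** A covering of [B] in [N], cut down to [B] and composed with [phi], covers [A] in [M]; each area
    grows by at most the factor [a]. It is used with [phi] equal to [vmap] and to [kmap]. *)
Lemma surface_measure_transport (M N : set V) (phi : V -> V) (J : V -> R)
    (A B : set V) (a : R) :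
  (forall U psi, regular_patch N U psi -> regular_patch M U (phi \o psi) /\
    forall u, U u -> enorm (normal (phi \o psi) u) =
      J (psi u) * enorm (normal psi u)) ->
  0 < a -> measurable (B : set (borel3 R)) ->
  (forall x, B x -> N x -> J x <= a) -> A `&` M `<=` phi @` (B `&` N) ->
  (surface_measure M A <= a%:E * surface_measure N B)%E.
Proof.
(* Division by [a] turns the claim into a lower bound for the infimum over coverings of [B]. *)
move=> HJ a0 mB JB AB; rewrite -lee_pdivrMl //.
apply: le_surface_measure => psi U K [c1 c2 c3].
rewrite lee_pdivrMl //.
(* The bound on [J] holds only over [B], whereas the pieces of a covering may extend beyond it. *)
pose L k := K k `&` psi k @^-1` B.
have mL k : measurable (L k).
  by have [mK KU] := c2 k; exact: (measurable_patch_piece (c1 k) mK KU mB).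
have LU k : L k `<=` U k.
  by apply: subset_trans (c2 k).2; exact: subIsetl.
have c : surface_cover M A (fun k => phi \o psi k) U L.
  split=> [k|//|x /AB [y [By Ny] yx]]; first by have [] := HJ _ _ (c1 k).
  have [k _ [u Ku uy]] := c3 _ (conj By Ny).
  by exists k => //; exists u; [split=> //=; rewrite uy|rewrite /= uy].
apply: le_trans (surface_measure_le c) _.
rewrite -nneseriesZl; last by move=> k _; exact: patch_area_ge0.
apply: lee_nneseries => [k _ _|k _]; first exact: patch_area_ge0.
have [phipsi E] := HJ _ _ (c1 k).
apply: (@le_trans _ _ (a%:E * patch_area (psi k) (L k))%E); last first.
  rewrite lee_pmul2l ?lte_fin //; have [mK KU] := c2 k.
  by apply: (le_patch_area (c1 k)) => //; exact: subIsetl.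
apply: (le_patch_area_scale (c1 k) phipsi (mL k) (LU k) a0) => u Lu.
rewrite (E _ (LU _ _ Lu)) ler_wpM2r ?enorm_ge0 //.
have [Ku Bu] := Lu; apply: JB => //.
exact: (patch_in (c1 k) (LU _ _ Lu)).
Qed.

End patch.

(** * The diffeomorphism *)

Section vmap_geometry.
Variable R : realType.
Local Notation V := 'rV[R]_3.
Implicit Types x y theta : V.

Definition wnorm x : R := Num.sqrt (1 + dotp x x).

Lemma wnorm_gt0 x : 0 < wnorm x.
Proof. by rewrite sqrtr_gt0 ltr_pwDl // dotp_ge0. Qed.

Lemma sqr_wnorm x : wnorm x ^+ 2 = 1 + dotp x x.
Proof. by rewrite sqr_sqrtr // addr_ge0 // dotp_ge0. Qed.

Lemma wnorm1_neq0 x : 1 + wnorm x != 0.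
Proof. by rewrite gt_eqF // addr_gt0 // wnorm_gt0. Qed.

(* Unlike the defining formula, this one is visibly smooth at the origin. *)
Lemma vmapE x : vmap x = (1 + wnorm x)^-1 *: x.
Proof.
have [->|x0] := eqVneq x 0; first by rewrite /vmap !scaler0.
rewrite /vmap scalerA; congr (_ *: _).
have n0 : 0 < enorm x by rewrite enorm_gt0.
have nn := lt0r_neq0 n0.
have -> : Num.sqrt (1 + (enorm x ^+ 2)^-1) = wnorm x / enorm x.
  apply: (pexpIrn (n := 2)) => //; rewrite ?nnegrE ?sqrtr_ge0 //.
    by rewrite divr_ge0 ?sqrtr_ge0.
  rewrite sqr_sqrtr ?addr_ge0 ?invr_ge0 ?sqr_ge0 // expr_div_n sqr_wnorm.
  by rewrite -sqr_enorm mulrDl mul1r divff ?sqrf_eq0 // addrC.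
(* This factorisation of |x|^2 = w^2 - 1 rationalises the formula for [vmap]. *)
have E : enorm x ^+ 2 = (wnorm x - 1) * (wnorm x + 1).
  by rewrite sqr_enorm -[RHS]addr0; have := sqr_wnorm x; lra.
have w1 := wnorm1_neq0 x.
apply: (mulIf w1); rewrite mulVf //; apply: (mulIf (expf_neq0 2 nn)).
rewrite mul1r {2}E; field.
by rewrite nn.
Qed.

Definition kmap y : V := (2 / (1 - dotp y y)) *: y.

Definition unit_ball : set V := [set y | dotp y y < 1].

Lemma one_sub_dotp_neq0 y : unit_ball y -> 1 - dotp y y != 0.
Proof. by move=> y1; rewrite gt_eqF // subr_gt0. Qed.

(** With w = [wnorm x] one has |x|^2 = w^2 - 1, hence |v(x)|^2 = (w - 1) / (w + 1). *)
Lemma one_sub_dotp_vmap x : 1 - dotp (vmap x) (vmap x) = 2 / (1 + wnorm x).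
Proof.
rewrite vmapE dotpZl dotpZr; have := sqr_wnorm x; have w1 := wnorm1_neq0 x.
move=> /(congr1 (fun z => z - 1)); rewrite addrAC subrr add0r => <-.
by field.
Qed.

Lemma unit_ball_vmap x : unit_ball (vmap x).
Proof.
rewrite /unit_ball /= -subr_gt0 one_sub_dotp_vmap divr_gt0 //.
by rewrite addr_gt0 // wnorm_gt0.
Qed.

Lemma vmapK : cancel (@vmap R) kmap.
Proof.
move=> x; rewrite /kmap one_sub_dotp_vmap vmapE scalerA.
rewrite (_ : _ * _ = 1) ?scale1r //; have w1 := wnorm1_neq0 x.
by field.
Qed.

(** With q = |y|^2, the sum 1 + |k(y)|^2 is a perfect square because (1 - q)^2 + 4 q = (1 + q)^2. *)
Lemma wnorm_kmap y : unit_ball y ->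
  wnorm (kmap y) = (1 + dotp y y) / (1 - dotp y y).
Proof.
move=> y1; have q0 := one_sub_dotp_neq0 y1.
have -> : (1 + dotp y y) / (1 - dotp y y) =
    `|(1 + dotp y y) / (1 - dotp y y)|.
  rewrite ger0_norm //; apply: divr_ge0; first by rewrite addr_ge0 // dotp_ge0.
  by rewrite subr_ge0 ltW.
rewrite -sqrtr_sqr /wnorm; congr Num.sqrt.
rewrite /kmap dotpZl dotpZr; field.
by [].
Qed.

Lemma kmapK y : unit_ball y -> vmap (kmap y) = y.
Proof.
move=> y1; have q0 := one_sub_dotp_neq0 y1.
rewrite vmapE wnorm_kmap // /kmap scalerA (_ : _ * _ = 1) ?scale1r //.
rewrite (_ : 1 + (1 + dotp y y) / (1 - dotp y y) = 2 / (1 - dotp y y)).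
  by field.
by field.
Qed.

Lemma enorm_lt1 y : (enorm y < 1) = (dotp y y < 1).
Proof.
rewrite -sqr_enorm; have := enorm_ge0 y.
by move=> y0; rewrite -[X in _ = (_ < X)](expr1n R 2) ltr_pXn2r ?nnegrE.
Qed.

Lemma enorm_vmap_lt1 x : enorm (vmap x) < 1.
Proof. by rewrite enorm_lt1; exact: unit_ball_vmap. Qed.

(** [alpha] is the radial profile of [kmap], so the correspondence of the annuli reduces to the
    monotonicity of [alpha]. *)
Lemma enorm_alpha x : enorm x = alpha (enorm (vmap x)).
Proof.
rewrite -{1}(vmapK x) /kmap enormZ /alpha sqr_enorm ger0_norm.
  by field; exact/one_sub_dotp_neq0/unit_ball_vmap.
by rewrite divr_ge0 // subr_ge0 ltW //; exact: unit_ball_vmap.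
Qed.

(** After clearing denominators the difference factors as 2 (1 + e t) (t - e). *)
Lemma ltr_alpha (e t : R) : 0 <= e < 1 -> 0 <= t < 1 ->
  (alpha e < alpha t) = (e < t).
Proof.
move=> /andP[e0 e1] /andP[t0 t1].
have e2 : 0 < 1 - e ^+ 2 by nra.
have t2 : 0 < 1 - t ^+ 2 by nra.
rewrite /alpha ltr_pdivrMr // mulrAC ltr_pdivlMr //.
have -> : (2 * e * (1 - t ^+ 2) < 2 * t * (1 - e ^+ 2)) =
   (0 < 2 * (1 + e * t) * (t - e)).
  by rewrite -subr_gt0; congr (0 < _); ring.
by rewrite pmulr_rgt0 ?subr_gt0 // mulr_gt0 // ltr_pwDl // mulr_ge0.
Qed.

Section annuli.
Variables (e1 e2 : R).
Hypotheses (he1 : 0 < e1) (he12 : e1 < e2) (he2 : e2 < 1).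

Lemma annulus_vmap x :
  annulus (alpha e1) (alpha e2) x <-> annulus e1 e2 (vmap x).
Proof.
have v01 : 0 <= enorm (vmap x) < 1 by rewrite enorm_ge0 enorm_vmap_lt1.
have h1 : 0 <= e1 < 1 by rewrite ltW //= (lt_trans he12).
have h2 : 0 <= e2 < 1 by rewrite he2 andbT ltW // (lt_trans he1).
by rewrite /annulus /= enorm_alpha (ltr_alpha h1 v01) (ltr_alpha v01 h2).
Qed.

Lemma annulus_unit_ball : annulus e1 e2 `<=` unit_ball.
Proof.
move=> y /andP[_ y2]; rewrite /unit_ball /= -enorm_lt1; exact: lt_trans he2.
Qed.

Lemma annulus_kmap y : annulus e1 e2 y -> annulus (alpha e1) (alpha e2) (kmap y).
Proof.
by move=> ay; apply/annulus_vmap; rewrite kmapK //; exact: annulus_unit_ball.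
Qed.

Lemma vmap_bij : set_bij (annulus (alpha e1) (alpha e2)) (annulus e1 e2) (@vmap R).
Proof.
split=> [x /annulus_vmap //|x y _ _|y ay]; first exact: (can_inj vmapK).
exists (kmap y); first exact: annulus_kmap.
by rewrite kmapK //; exact: annulus_unit_ball.
Qed.

End annuli.

Lemma Cn_dotp n A (F G : V -> V) : open A -> Cn n A F -> Cn n A G ->
  Cn n A (fun x => dotp (F x) (G x)).
Proof.
by move=> oA CF CG; apply: Cn_sum => // i _; apply: CnM => //; apply: Cn_coord.
Qed.

Lemma continuous_dotp : continuous (fun x : V => dotp x x).
Proof.
move=> x; apply: (@Cn_continuous R _ 0 setT) => //.
by apply: Cn_dotp; [exact: openT|exact: (Cn_id openT 0)|exact: (Cn_id openT 0)].
Qed.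

Lemma open_unit_ball : open unit_ball.
Proof.
by apply: (@open_comp _ _ (fun x : V => dotp x x) [set a : R | a < 1]) => [x _|];
  [exact: continuous_dotp|exact: open_lt].
Qed.

Lemma continuous_enorm : continuous (@enorm R).
Proof.
move=> x; apply: (@continuous_comp _ _ _ (fun x : V => dotp x x) (@Num.sqrt R)).
  exact: continuous_dotp.
exact: sqrt_continuous.
Qed.

Lemma open_annulus (a b : R) : open (annulus a b : set V).
Proof.
apply: (@open_comp _ _ (@enorm R) [set c : R | a < c < b]) => [x _|].
  exact: continuous_enorm.
have -> : [set c : R | a < c < b] = `]a, b[%classic.
  by apply/seteqP; split => c /=; rewrite in_itv.
exact: interval_open.
Qed.

Lemma Cn_vmap n : Cn n setT (@vmap R).
Proof.
have oT := @openT V; have C1 : Cn n setT (fun=> 1 : R) by exact: Cn_cst.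
have Cd := Cn_dotp oT (Cn_id oT n) (Cn_id oT n).
have Cw : Cn n setT (fun x : V => 1 + wnorm x).
  apply: CnD => //; apply: Cn_sqrt => //; last exact: CnD.
  by move=> x _; rewrite ltr_pwDl // dotp_ge0.
apply: Cn_row => // j; apply: Cn_ext (CnM oT (CnV oT _ Cw) (Cn_coord oT j (Cn_id oT n))) => //.
- by move=> x _; rewrite vmapE mxE.
- by move=> x _; exact: wnorm1_neq0.
Qed.

Lemma Cn_kmap n : Cn n unit_ball kmap.
Proof.
have oB := open_unit_ball; have C1 : Cn n unit_ball (fun=> 1 : R) by exact: Cn_cst.
have C2 : Cn n unit_ball (fun=> 2 : R) by exact: Cn_cst.
have Cd := Cn_dotp oB (Cn_id oB n) (Cn_id oB n).
have Cq := CnM oB C2 (CnV oB one_sub_dotp_neq0 (CnB oB C1 Cd)).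
apply: Cn_row => // j; apply: Cn_ext (CnM oB Cq (Cn_coord oB j (Cn_id oB n))) => //.
by move=> x _; rewrite mxE.
Qed.

Lemma vmap_diffeomorphism (e1 e2 : R) : 0 < e1 -> e1 < e2 -> e2 < 1 ->
  diffeomorphism (annulus (alpha e1) (alpha e2)) (annulus e1 e2) (@vmap R).
Proof.
move=> e10 e12 e21; split; first exact: vmap_bij.
  by apply/smooth_onP => n; apply: sub_Cn (Cn_vmap n).
exists kmap => [|x _]; last exact: vmapK.
by apply/smooth_onP => n; apply: sub_Cn (Cn_kmap n); exact: annulus_unit_ball.
Qed.

Lemma differentiable_vmap x : differentiable (@vmap R) x.
Proof. exact: Cn_differentiable (Cn_vmap 0) I. Qed.

Lemma differentiable_kmap y : unit_ball y -> differentiable kmap y.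
Proof. exact: Cn_differentiable (Cn_kmap 0). Qed.

(** This is the chain rule for k o v = id, read row by row. Jacobians act on row vectors from the
    right, so the inner map comes first. *)
Lemma jacobian_vmap_kmap x : 'J (@vmap R) x *m 'J kmap (vmap x) = 1%:M.
Proof.
apply/row_matrixP => i; rewrite rowE [RHS]rowE mulmx1 mulmxA.
have dv := differentiable_vmap x.
have dk := differentiable_kmap (unit_ball_vmap x).
rewrite -(deriveEjacobian _ dv) -(deriveEjacobian _ dk) -derive_comp //.
by rewrite (_ : kmap \o _ = id) ?derive_id //; apply/funext => z; exact: vmapK.
Qed.

Lemma det_jacobian_vmap x : \det ('J (@vmap R) x) != 0.
Proof.
by have [+ _] := mulmx1_unit (jacobian_vmap_kmap x); rewrite unitmxE unitfE.
Qed.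

Lemma det_jacobian_kmap y : unit_ball y -> \det ('J kmap y) != 0.
Proof.
move=> y1; have [_] := mulmx1_unit (jacobian_vmap_kmap (kmap y)).
by rewrite kmapK // unitmxE unitfE.
Qed.

Lemma jacobianE (F : V -> V) x i j : differentiable F x ->
  'J F x i j = ('D_('e_i) F x) 0 j.
Proof. by move=> dF; rewrite deriveEjacobian // -rowE [RHS]mxE. Qed.

(** The determinant never vanishes, so its absolute value is as smooth as the determinant itself. *)
Lemma Cn_det_jacobian_vmap n : Cn n setT (fun x => `|\det ('J (@vmap R) x)|).
Proof.
have oT := @openT V.
apply: Cn_norm => // [x _|]; first exact: det_jacobian_vmap.
apply: Cn_det => // i j.
apply: Cn_ext (Cn_coord oT j ((Cn_vmap n.+1).2 i)) => // x _.
by rewrite jacobianE //; exact: differentiable_vmap.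
Qed.

(** The support of the pullback lies in the preimage under v of the support S of [f]. That preimage
    is k(S), because S lies in the unit ball, and is therefore compact. *)
Lemma test_function_weighted_pullback (e1 e2 : R) (f : V -> R) :
  0 < e1 -> e1 < e2 -> e2 < 1 -> test_function (annulus e1 e2) f ->
  test_function (annulus (alpha e1) (alpha e2)) (weighted_pullback f).
Proof.
move=> e10 e12 e21 [sf cf ff].
set S := closure [set x | f x != 0] in cf ff *.
have cv : continuous (@vmap R).
  by move=> x; exact/differentiable_continuous/differentiable_vmap.
have cS : closed S by exact: closed_closure.
have clv : closed (@vmap R @^-1` S).
  by apply: preimage_closed => // x _; exact: cv.
have sub : closure [set x | weighted_pullback f x != 0] `<=` @vmap R @^-1` S.
  rewrite closureE; apply: smallest_sub => // x /=.
  by rewrite mulf_eq0 negb_or => /andP[_ fx]; apply: subset_closure.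
have preE : @vmap R @^-1` S = kmap @` S.
  apply/seteqP; split => [x Sx|_ [y Sy <-]]; first by exists (vmap x) => //; exact: vmapK.
  by rewrite /= kmapK //; apply: (annulus_unit_ball (e1 := e1) e21); exact: ff.
split.
- apply/smooth_onP => n; apply: CnM; [exact: openT|exact: Cn_det_jacobian_vmap|].
  have /smooth_onP/(_ n) Cf := sf.
  exact: (Cn_comp (@openT V) _ (Cn_vmap n) Cf).
- have cK : compact (@vmap R @^-1` S).
    rewrite preE; apply: continuous_compact cf.
    apply: continuous_in_subspaceT => y /set_mem Sy.
    apply/differentiable_continuous/differentiable_kmap.
    by apply: (annulus_unit_ball (e1 := e1) e21); exact: ff.
  exact: subclosed_compact (@closed_closure _ _) cK sub.
- by move=> x /sub Sx; apply/annulus_vmap => //; exact: ff.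
Qed.

End vmap_geometry.

(** * Patches and level sets *)

Section patch_composition.
Variable R : realType.
Local Notation V := 'rV[R]_3.
Implicit Types (M N A : set V) (phi : V -> V).

Lemma derive_dotp_gradient (g : V -> R) x w : differentiable g x ->
  'D_w g x = dotp w (gradient g x).
Proof.
move=> dg; rewrite (deriveE_partial _ dg); apply: eq_bigr => j _.
by rewrite [X in _ = _ * X]mxE.
Qed.

(** Row i of ['J v x] is the derivative of [v] along the i-th basis vector, whence the transpose. *)
Lemma gradient_comp (h : V -> R) (v : V -> V) x :
  differentiable v x -> differentiable h (v x) ->
  gradient (h \o v) x = gradient h (v x) *m ('J v x)^T.
Proof.
move=> dv dh; apply/rowP => i; rewrite [LHS]mxE (derive_comp _ dv dh).
rewrite derive_dotp_gradient // [RHS]mxE; apply: eq_bigr => j _.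
by rewrite [X in _ = _ * X]mxE jacobianE // mulrC.
Qed.

Lemma normal_comp phi (psi : R * R -> V) u :
  differentiable psi u -> differentiable phi (psi u) ->
  normal (phi \o psi) u = crossp ('D_((1, 0) : R * R) psi u *m 'J phi (psi u))
                                 ('D_((0, 1) : R * R) psi u *m 'J phi (psi u)).
Proof.
by move=> dpsi dphi; rewrite /normal !(derive_comp _ dpsi dphi) !(deriveEjacobian _ dphi).
Qed.

(** Near [u] the chain rule writes the derivative as a combination [F] of partial derivatives of
    [phi] whose ingredients are all continuous at [u]. *)
Lemma continuous_derive_comp A phi (psi : R * R -> V) U w u : open U -> U u ->
  (forall t, U t -> differentiable psi t) -> (forall t, U t -> A (psi t)) ->
  Cn 1 A phi -> {for u, continuous ('D_w psi)} ->
  {for u, continuous ('D_w (phi \o psi))}.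
Proof.
move=> oU Uu dpsi psiA Cphi cpsi.
have dphi t : U t -> differentiable phi (psi t).
  by move=> Ut; exact: Cn_differentiable Cphi (psiA _ Ut).
pose F t := ('D_w psi t) 0 0 *: 'D_('e_0) phi (psi t)
    + ('D_w psi t) 0 1 *: 'D_('e_1) phi (psi t)
    + ('D_w psi t) 0 2%:R *: 'D_('e_(2%:R)) phi (psi t).
have E t : U t -> 'D_w (phi \o psi) t = F t.
  move=> Ut; rewrite (derive_comp _ (dpsi _ Ut) (dphi _ Ut)).
  by rewrite (deriveE_partial _ (dphi _ Ut)) sum3E.
have cj (j : 'I_3) : {for u, continuous (fun t => 'D_('e_j) phi (psi t))}.
  apply: (@continuous_comp _ _ _ psi ('D_('e_j) phi)).
    exact: differentiable_continuous (dpsi _ Uu).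
  exact: differentiable_continuous (Cphi.2 j _ (psiA _ Uu)).
have ci (j : 'I_3) : {for u, continuous (fun t => ('D_w psi t) 0 j)}.
  by apply: (@continuous_comp _ _ _ ('D_w psi) (fun x : V => x 0 j)) => //;
    exact: coord_continuous.
have cF : {for u, continuous F}.
  apply: cvgD; first apply: cvgD; apply: cvgZ;
    [exact: (ci 0)|exact: (cj 0)|exact: (ci 1)|exact: (cj 1)|
     exact: (ci 2%:R)|exact: (cj 2%:R)].
have FE : \forall t \near u, F t = 'D_w (phi \o psi) t.
  by apply: filterS (open_nbhs_nbhs (conj oU Uu)) => t /E ->.
move: cF; rewrite /prop_for /continuous_at -(E _ Uu) => cF.
by apply: cvg_trans cF; exact: near_eq_cvg.
Qed.

Lemma regular_patch_comp M N A phi U psi : Cn 1 A phi -> N `<=` A ->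
  (forall x, N x -> M (phi x)) -> set_inj N phi ->
  (forall x, N x -> \det ('J phi x) != 0) ->
  regular_patch N U psi -> regular_patch M U (phi \o psi).
Proof.
move=> Cphi NA NM iphi dphi0 [oU psiN ipsi rpsi].
have dpsi t : U t -> differentiable psi t by move=> /rpsi[].
have psiA t : U t -> A (psi t) by move=> Ut; apply: NA; exact: psiN.
have dphi t : U t -> differentiable phi (psi t).
  by move=> Ut; exact: Cn_differentiable Cphi (psiA _ Ut).
split=> [|u Uu|u t Uu Ut /= e|u Uu].
- exact: oU.
- by apply: NM; exact: psiN.
- by apply: ipsi => //; apply: iphi => //; rewrite inE; apply: psiN; rewrite -inE.
have [_ c1 c2 n0] := rpsi _ Uu.
split.
- exact: differentiable_comp (dpsi _ Uu) (dphi _ Uu).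
- exact: (continuous_derive_comp oU Uu dpsi psiA Cphi) c1.
- exact: (continuous_derive_comp oU Uu dpsi psiA Cphi) c2.
rewrite (normal_comp (dpsi _ Uu) (dphi _ Uu)); apply: crossp_neq0_mulmx => //.
by apply: dphi0; exact: psiN.
Qed.

(** [G \o psi] vanishes on the open set [U], so its directional derivatives vanish there too. *)
Lemma tangent_level_set (G : V -> R) M U psi w u :
  (forall x, M x -> G x = 0) -> regular_patch M U psi -> U u ->
  differentiable G (psi u) -> dotp ('D_w psi u) (gradient G (psi u)) = 0.
Proof.
move=> G0 Upsi Uu dG; rewrite -derive_dotp_gradient //.
rewrite -(derive_comp _ (patch_differentiable Upsi Uu)) //.
rewrite (near_eq_derive (g := fun=> 0)); first exact: derive_cst.
apply: filterS (open_nbhs_nbhs (conj (patch_open Upsi) Uu)) => t Ut.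
by apply: G0; exact: (patch_in Upsi).
Qed.

Lemma near_eq_normal (psi psi' : R * R -> V) u :
  (\near u, psi u = psi' u) -> normal psi u = normal psi' u.
Proof. by move=> e; rewrite /normal !(near_eq_derive _ e). Qed.

End patch_composition.

(** * Spindles and cylinders *)

Section spindle_cylinder.
Variable R : realType.
Local Notation V := 'rV[R]_3.
Variables (s : R) (theta : V).
Hypotheses (s0 : 0 < s) (theta1 : enorm theta = 1).

Definition cylinder_h (x : V) : R := enorm x ^+ 2 - dotp x theta ^+ 2 - s.

Local Notation G := cylinder_h.
Local Notation h := (fun y : V => spindle_h s y theta).

(** For a unit [theta], Lagrange's identity gives |v x theta|^2 = (|x|^2 - (x . theta)^2) / (1 +
    w)^2 with w = [wnorm x], while (1 - |v|^2)^2 = 4 / (1 + w)^2; the common factors cancel. *)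
Lemma spindle_h_vmap x : h (vmap x) = G x.
Proof.
have th : dotp theta theta = 1 by rewrite -sqr_enorm theta1 expr1n.
rewrite /spindle_h /cylinder_h sqr_enorm_crossp !sqr_enorm th mulr1.
rewrite one_sub_dotp_vmap; have w1 := wnorm1_neq0 x.
rewrite vmapE !dotpZl dotpZr; field.
by [].
Qed.

Lemma spindle_h_kmap y : unit_ball y -> h y = G (kmap y).
Proof. by move=> y1; rewrite -spindle_h_vmap kmapK. Qed.

Lemma Cn_cylinder_h n : Cn n setT G.
Proof.
have oT := @openT V; have Ci := Cn_id oT n.
have Ct : Cn n setT (fun=> theta) by exact: Cn_cst.
have Cs : Cn n setT (fun=> s) by exact: Cn_cst.
have C := CnB oT (CnB oT (Cn_dotp oT Ci Ci) (CnX oT 2 (Cn_dotp oT Ci Ct))) Cs.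
by apply: Cn_ext C => // x _; rewrite /cylinder_h sqr_enorm.
Qed.

(** On the unit ball [h] is the polynomial [cylinder_h] composed with the smooth map [kmap]. *)
Lemma Cn_spindle_h n : Cn n (@unit_ball R) h.
Proof.
have oB := @open_unit_ball R.
have C : Cn n (@unit_ball R) (G \o @kmap R).
  exact: (Cn_comp oB (fun _ _ => I) (@Cn_kmap R n) (Cn_cylinder_h n)).
by apply: Cn_ext C => // y y1 /=; rewrite spindle_h_kmap.
Qed.

Lemma differentiable_cylinder_h x : differentiable G x.
Proof. exact: (Cn_differentiable (Cn_cylinder_h 0) I). Qed.

Lemma differentiable_spindle_h y : unit_ball y -> differentiable h y.
Proof. exact: (Cn_differentiable (Cn_spindle_h 0)). Qed.

(* Euler's identity for the quadratic form underlying cylinder_h. *)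
Lemma derive_cylinder_h_radial x : 'D_x G x = 2 * (G x + s).
Proof.
set Q := G x + s.
(* [phi t] is the value of [cylinder_h] at (1 + t) x, and its derivative at 0 is 2 Q. *)
pose phi (t : R) : R := (1 + t) ^+ 2 * Q - s.
have E : 'D_x G x = 'D_1 phi 0.
  rewrite /derive.
  suff -> : (fun t : R => t^-1 *: ((G \o shift x) (t *: x) - G x)) =
      (fun t : R => t^-1 *: ((phi \o shift 0) (t *: 1) - phi 0)) by [].
  apply/funext => t; congr (_ *: (_ - _)); last by rewrite /phi /Q; ring.
  rewrite /= (_ : t *: x + x = (1 + t) *: x); last first.
    by rewrite scalerDl scale1r addrC.
  rewrite /phi /Q /cylinder_h !sqr_enorm !dotpZl dotpZr.
  by rewrite -[t *: 1]/(t * 1); ring.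
rewrite E; apply: derive_val; apply: is_derive_eq.
rewrite -?[_ *: _]/(_ * _); ring.
Qed.

(** On the zero set the radial derivative equals 2 s, which is positive. *)
Lemma gradient_cylinder_h_neq0 x : G x = 0 -> gradient G x != 0.
Proof.
move=> Gx; apply/eqP => g0; have := derive_cylinder_h_radial x.
rewrite derive_dotp_gradient; last exact: differentiable_cylinder_h.
rewrite g0 Gx add0r /dotp big1 => [/eqP|i _]; last by rewrite mxE mulr0.
by rewrite eq_sym mulf_eq0 pnatr_eq0 /= gt_eqF.
Qed.

Lemma gradient_cylinder_h x :
  gradient G x = gradient h (vmap x) *m ('J (@vmap R) x)^T.
Proof.
have dh := differentiable_spindle_h (unit_ball_vmap x).
rewrite -(gradient_comp (differentiable_vmap x) dh).
have e : h \o @vmap R = G by apply/funext => z; exact: spindle_h_vmap.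
by rewrite e.
Qed.

Lemma gradient_spindle_h_eq0 x :
  (gradient h (vmap x) == 0) = (gradient G x == 0).
Proof.
rewrite gradient_cylinder_h; apply/eqP/eqP => [->|g0]; first by rewrite mul0mx.
have Bu : ('J (@vmap R) x)^T \in unitmx.
  by rewrite unitmx_tr unitmxE unitfE det_jacobian_vmap.
by apply: (can_inj (mulmxK Bu)); rewrite g0 mul0mx.
Qed.

Definition area_factor (x : V) : R :=
  `|\det ('J (@vmap R) x)| * enorm (gradient h (vmap x)) / enorm (gradient G x).

Lemma area_factor_gt0 x : gradient G x != 0 -> 0 < area_factor x.
Proof.
move=> g0; rewrite /area_factor divr_gt0 ?mulr_gt0 ?normr_gt0 ?enorm_gt0 //.
  exact: det_jacobian_vmap.
by rewrite gradient_spindle_h_eq0.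
Qed.

Variables e1 e2 : R.
Hypotheses (he1 : 0 < e1) (he12 : e1 < e2) (he2 : e2 < 1).

Definition spindle : set V := [set y | annulus e1 e2 y /\ h y = 0].
Definition cylinder : set V :=
  [set x | annulus (alpha e1) (alpha e2) x /\ G x = 0].

Lemma cylinder_vmap x : cylinder x <-> spindle (vmap x).
Proof.
rewrite /cylinder /spindle /= spindle_h_vmap.
by split=> -[/(annulus_vmap he1 he12 he2) ? ?].
Qed.

Lemma spindle_unit_ball : spindle `<=` @unit_ball R.
Proof. by move=> y [ay _]; exact: (annulus_unit_ball he2 ay). Qed.

Lemma spindle_kmap y : spindle y -> cylinder (kmap y).
Proof.
by move=> My; apply/cylinder_vmap; rewrite kmapK //; exact: spindle_unit_ball.
Qed.

Lemma regular_patch_vmap U psi : regular_patch cylinder U psi ->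
  regular_patch spindle U (@vmap R \o psi).
Proof.
apply: (regular_patch_comp (@Cn_vmap R 1)) => //.
- by move=> x /cylinder_vmap.
- by move=> x y _ _; exact: (can_inj (@vmapK R)).
- by move=> x _; exact: det_jacobian_vmap.
Qed.

Lemma regular_patch_kmap U psi : regular_patch spindle U psi ->
  regular_patch cylinder U (@kmap R \o psi).
Proof.
apply: (regular_patch_comp (@Cn_kmap R 1)).
- exact: spindle_unit_ball.
- exact: spindle_kmap.
- move=> x y /set_mem/spindle_unit_ball x1 /set_mem/spindle_unit_ball y1 e.
  by rewrite -(kmapK x1) e kmapK.
- by move=> x /spindle_unit_ball; exact: det_jacobian_kmap.
Qed.

Lemma enorm_normal_vmap U psi u : regular_patch cylinder U psi -> U u ->
  enorm (normal (@vmap R \o psi) u) = area_factor (psi u) * enorm (normal psi u).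
Proof.
move=> Upsi Uu; have dG := differentiable_cylinder_h.
have G0 x : cylinder x -> G x = 0 by case.
have N := patch_in Upsi Uu.
rewrite (normal_comp (patch_differentiable Upsi Uu) (differentiable_vmap _)).
apply: (enorm_crossp_mulmx (gradient_cylinder_h _)).
- exact: det_jacobian_vmap.
- exact/gradient_cylinder_h_neq0/G0.
- exact: (tangent_level_set _ G0 Upsi Uu (dG _)).
- exact: (tangent_level_set _ G0 Upsi Uu (dG _)).
Qed.

(** On [U] the composite v o k o psi is [psi], so the formula for [vmap], applied to the patch k o
    psi, can be inverted. *)
Lemma enorm_normal_kmap U psi u : regular_patch spindle U psi -> U u ->
  enorm (normal (@kmap R \o psi) u) =
  (area_factor (kmap (psi u)))^-1 * enorm (normal psi u).
Proof.
move=> Upsi Uu; have Npsi := regular_patch_kmap Upsi.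
have [_ Gk] := patch_in Npsi Uu.
have j0 := area_factor_gt0 (gradient_cylinder_h_neq0 Gk).
have e : \near u, (@vmap R \o (@kmap R \o psi)) u = psi u.
  apply: filterS (open_nbhs_nbhs (conj (patch_open Upsi) Uu)) => t Ut /=.
  by rewrite kmapK //; apply: spindle_unit_ball; exact: (patch_in Upsi).
rewrite -(near_eq_normal e) (enorm_normal_vmap Npsi Uu) mulKf //.
exact: lt0r_neq0.
Qed.

Lemma measurable_vmap :
  measurable_fun setT (@vmap R : borel3 R -> borel3 R).
Proof.
apply: continuous_measurable_borel3 => x.
exact/differentiable_continuous/differentiable_vmap.
Qed.

Lemma measurable_vmap_preimage (A : set (borel3 R)) :
  measurable A -> measurable (@vmap R @^-1` A : set (borel3 R)).
Proof. by move=> mA; rewrite -[_ @^-1` _]setTI; exact: measurable_vmap. Qed.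

Lemma spindle_measure_le (A : set (borel3 R)) (a : R) :
  measurable A -> A `<=` spindle -> 0 < a ->
  (forall y, A y -> area_factor (kmap y) <= a) ->
  (surface_measure spindle A <=
   a%:E * surface_measure cylinder (@vmap R @^-1` A))%E.
Proof.
move=> mA AM a0 Aa; apply: (@surface_measure_transport R spindle cylinder (@vmap R)
  area_factor A (@vmap R @^-1` A) a).
- move=> U psi Upsi; split; first exact: regular_patch_vmap.
  by move=> u; exact: enorm_normal_vmap.
- exact: a0.
- exact: measurable_vmap_preimage.
- by move=> x /= /Aa; rewrite vmapK.
- move=> y [Ay My]; exists (kmap y); last exact/kmapK/spindle_unit_ball.
  split; last exact: spindle_kmap.
  by rewrite /= kmapK //; exact: spindle_unit_ball.
Qed.

(** The lower bound is an upper bound for the inverse map: areas are transported along [kmap], whose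
    factor is the inverse one. *)
Lemma spindle_measure_ge (A : set (borel3 R)) (a : R) :
  measurable A -> A `<=` spindle -> 0 < a ->
  (forall y, A y -> a <= area_factor (kmap y)) ->
  (a%:E * surface_measure cylinder (@vmap R @^-1` A) <=
   surface_measure spindle A)%E.
Proof.
move=> mA AM a0 Aa; rewrite -lee_pdivlMl //.
apply: (@surface_measure_transport R cylinder spindle (@kmap R)
  (fun y => (area_factor (kmap y))^-1) _ A a^-1).
- move=> U psi Upsi; split; first exact: regular_patch_kmap.
  by move=> u; exact: enorm_normal_kmap.
- by rewrite invr_gt0.
- exact: mA.
- move=> y /Aa ay _; rewrite lef_pV2 ?posrE //; exact: lt_le_trans ay.
- move=> x [Ax /cylinder_vmap Mx]; exists (vmap x); last exact: vmapK.
  by split.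
Qed.

Lemma continuous_enorm_gradient (g : V -> R) A x : open A -> Cn 1 A g -> A x ->
  {for x, continuous (fun z => enorm (gradient g z))}.
Proof.
move=> oA Cg Ax; have Cgrad : Cn 0 A (gradient g).
  apply: (Cn_row oA) => j; have Cj : Cn 0 A ('D_('e_j) g) := Cg.2 j.
  by apply: Cn_ext Cj => // z _; rewrite mxE.
apply: (@continuous_comp _ _ _ (gradient g) (@enorm R)).
  exact: Cn_continuous Cgrad Ax.
exact: continuous_enorm.
Qed.

Lemma continuous_area_factor x : gradient G x != 0 ->
  {for x, continuous area_factor}.
Proof.
move=> g0.
have cJ : {for x, continuous (fun z => `|\det ('J (@vmap R) z)|)}.
  exact: Cn_continuous (@Cn_det_jacobian_vmap R 0) I.
have ch : {for x, continuous (fun z => enorm (gradient h (vmap z)))}.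
  apply: (@continuous_comp _ _ _ (@vmap R) (fun y => enorm (gradient h y))).
    exact/differentiable_continuous/differentiable_vmap.
  apply: (continuous_enorm_gradient (@open_unit_ball R) (Cn_spindle_h 1)).
  exact: unit_ball_vmap.
have cG : {for x, continuous (fun z => enorm (gradient G z))}.
  exact: (continuous_enorm_gradient (@openT V) (Cn_cylinder_h 1) I).
have nG : enorm (gradient G x) != 0 by rewrite enorm_eq0.
exact: cvgM (cvgM cJ ch) (cvgV nG cG).
Qed.

(** An open neighbourhood of the spindle on which the gradient of [h] does not vanish. The integrand
    and the area factor are continuous on it, hence Borel measurable on the spindle. *)
Let O : set V :=
  @unit_ball R `&` (fun y => enorm (gradient h y)) @^-1` [set a | 0 < a].

Let openO : open O.
Proof.
apply: open_setI_preimage; [exact: open_unit_ball| |exact: open_gt].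
move=> y; exact: (continuous_enorm_gradient (@open_unit_ball R) (Cn_spindle_h 1)).
Qed.

Let spindleO : spindle `<=` O.
Proof.
move=> y My; have y1 := spindle_unit_ball My; split => //=.
have [_ Gk] := spindle_kmap My.
by rewrite enorm_gt0 -(kmapK y1) gradient_spindle_h_eq0 gradient_cylinder_h_neq0.
Qed.

Lemma measurable_spindle : measurable (spindle : set (borel3 R)).
Proof.
have oA : open (annulus e1 e2 : set V) by exact: open_annulus.
have mh : measurable_fun (annulus e1 e2 : set (borel3 R)) h.
  apply: continuous_measurable_borel3_real => // y Ay.
  apply/differentiable_continuous/differentiable_spindle_h.
  exact: (annulus_unit_ball he2 Ay).
exact: (mh (open_measurable_borel3 oA) [set 0] (measurable_set1 0)).
Qed.

Lemma measurable_on_spindle (g : V -> R) :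
  (forall y, O y -> {for y, continuous g}) ->
  measurable_fun (spindle : set (borel3 R)) g.
Proof.
move=> cg; have mg := continuous_measurable_borel3_real openO cg.
by apply: measurable_funS mg; [exact: open_measurable_borel3|exact: spindleO].
Qed.

Lemma surface_integral_spindle (f : V -> R) : continuous f ->
  (\int[surface_measure spindle : set (borel3 R) -> \bar R]_(y in
      (spindle : set (borel3 R)))
     (f y / enorm (gradient h y) / enorm (gradient h y))%:E =
   \int[surface_measure cylinder : set (borel3 R) -> \bar R]_(x in
      (cylinder : set (borel3 R)))
     (weighted_pullback f x / enorm (gradient h (vmap x))
        / enorm (gradient G x))%:E)%E.
Proof.
move=> cf.
have cgh y : O y -> {for y, continuous (fun z => (enorm (gradient h z))^-1)}.
  move=> [y1 /= n0]; have ne0 := lt0r_neq0 n0.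
  have ch := continuous_enorm_gradient (@open_unit_ball R) (Cn_spindle_h 1) y1.
  exact: cvgV ne0 ch.
have mF : measurable_fun (spindle : set (borel3 R))
    (fun y => f y / enorm (gradient h y) / enorm (gradient h y)).
  apply: measurable_on_spindle => y Oy.
  exact: cvgM (cvgM (cf y) (cgh y Oy)) (cgh y Oy).
have mJ : measurable_fun (spindle : set (borel3 R)) (area_factor \o @kmap R).
  apply: measurable_on_spindle => y [y1 /= n0].
  apply: continuous_comp.
    exact/differentiable_continuous/differentiable_kmap.
  apply: continuous_area_factor.
  by rewrite -gradient_spindle_h_eq0 kmapK // -enorm_gt0.
have J0 y : spindle y -> 0 < (area_factor \o @kmap R) y.
  by move=> /spindle_kmap[_ Gk] /=; exact/area_factor_gt0/gradient_cylinder_h_neq0.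
(* The area factor lives on the cylinder, so as a density on the spindle it is read through
   [kmap]. *)
have -> := @integral_change_of_variables _ _ (borel3 R) (borel3 R) R (@vmap R)
  measurable_vmap (surface_measure cylinder) (surface_measure spindle) spindle
  (area_factor \o @kmap R) measurable_spindle mJ J0 spindle_measure_le
  spindle_measure_ge _ mF.
have -> : @vmap R @^-1` spindle = cylinder.
  by apply/seteqP; split => x /cylinder_vmap.
apply: eq_integral => x /set_mem [_ Gx]; congr EFin.
(* The factor |grad h| of the density cancels one of the two in the denominator; |det Dv| becomes
   the weight of the pullback and 1 / |grad G| the delta factor of the cylinder. *)
rewrite /= vmapK /area_factor /weighted_pullback.
have : enorm (gradient h (vmap x)) != 0.
  by rewrite enorm_eq0 gradient_spindle_h_eq0 gradient_cylinder_h_neq0.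
have : enorm (gradient G x) != 0 by rewrite enorm_eq0 gradient_cylinder_h_neq0.
move: (enorm _) (enorm _) (`| _ |) (f _) => a b c e a0 b0.
by field; rewrite a0 b0.
Qed.

End spindle_cylinder.

Theorem mainTheorem6 (R : realType) (eps1 eps2 : R)
  (heps1 : 0 < eps1) (heps12 : eps1 < eps2) (heps2 : eps2 < 1) :
  diffeomorphism (annulus (alpha eps1) (alpha eps2)) (annulus eps1 eps2)
    (@vmap R) /\
  forall f : 'rV[R]_3 -> R, test_function (annulus eps1 eps2) f ->
    test_function (annulus (alpha eps1) (alpha eps2)) (weighted_pullback f) /\
    forall (s : R) (theta : 'rV[R]_3),
      0 < s < 1 -> enorm theta = 1 ->
      spindle_transform eps1 eps2 f s theta =
      cylinder_transform (alpha eps1) (alpha eps2) (weighted_pullback f)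
        s theta.
Proof.
split; first exact: vmap_diffeomorphism.
move=> f tf; split; first exact: test_function_weighted_pullback.
move=> s theta /andP[s0 _] theta1.
have cf : continuous f.
  by move=> x; case: tf => /(_ [::] x I) /differentiable_continuous.
(* Both transforms unfold to [fine] of an extended real integral, and these integrals agree before
   [fine] is applied. *)
congr fine; exact: (surface_integral_spindle s0 theta1 heps1 heps12 heps2 cf).
Qed.
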